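(* The maximum likelihood estimators of Gaussian mixture models are transcendental functions (that is, they are not algebraic functions of the data). More precisely, there exist rational samples $x_1,x_2,\ldots,x_N$ in $\mathbb{Q}^n$ whose maximum likelihood parameters for the mixture of two $n$-dimensional Gaussians are not algebraic numbers over $\mathbb{Q}$, in the following sense: every non-trivial critical point $(\hat\alpha,\hat\mu_1,\hat\mu_2,\hat\Sigma_1,\hat\Sigma_2)$ of the log-likelihood function $\ell$ of the sample has at least one coordinate that is transcendental over $\mathbb{Q}$.
   Context: Here $n\ge 1$. The mixture of two $n$-dimensional Gaussians is the family of probability densities on $\mathbb{R}^n$ $$f_{\alpha,\mu,\Sigma}(x) = \alpha\, \varphi(x;\mu_1,\Sigma_1) + (1-\alpha)\,\varphi(x;\mu_2,\Sigma_2),$$ where $$\varphi(x;m,S) = (2\pi)^{-n/2}\det(S)^{-1/2}\exp\left(-\tfrac12 (x-m)^T S^{-1}(x-m)\right).$$ The parameters are the mixture weight $\alpha\in[0,1]$, the mean vectors $\mu_1,\mu_2\in\mathbb{R}^n$, and the positive definite (symmetric, real, $n\times n$) covariance matrices $\Sigma_1,\Sigma_2$. For $n=1$ one uses the standard deviations $\sigma_1,\sigma_2>0$ with $\Sigma_j=\sigma_j^2$ as parameters; this does not affect whether a parameter point is algebraic. The coordinates of a parameter point are the number $\alpha$, the entries of $\mu_1,\mu_2$, and the entries of $\Sigma_1,\Sigma_2$ (for $n=1$: $\alpha,\mu_1,\mu_2,\sigma_1,\sigma_2$). For fixed data $x_1,\ldots,x_N$, the log-likelihood function is $\ell(\alpha,\mu_1,\mu_2,\Sigma_1,\Sigma_2)=\sum_{i=1}^N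 \log f_{\alpha,\mu,\Sigma}(x_i)$, regarded as a function of the parameters. A critical point of $\ell$ is a parameter point at which all partial derivatives of $\ell$ with respect to the parameters vanish. It is called non-trivial if it yields an honest mixture, i.e. a distribution that is not Gaussian; equivalently, $0<\hat\alpha<1$ and $(\hat\mu_1,\hat\Sigma_1)\neq(\hat\mu_2,\hat\Sigma_2)$. With arbitrary means and covariances the log-likelihood can be unbounded above, so that there is no global maximum; maximum likelihood for Gaussian mixtures then means computing local maxima of $\ell$. The statement about non-trivial critical points covers non-trivial local maxima. *)

(* Defs.v *)
(* MathComp / MathComp-Analysis *)
From mathcomp Require Import all_boot all_order all_algebra.
From mathcomp Require Import all_classical all_reals all_analysis.

Set Implicit Arguments.
Unset Strict Implicit.
Unset Printing Implicit Defensive.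

Import Order.TTheory GRing.Theory Num.Theory.
Import numFieldNormedType.Exports.

Local Open Scope ring_scope.

Definition posdefmx (R : realType) (n : nat) (S : 'M[R]_n) : Prop :=
  S^T = S /\ (forall v : 'cV[R]_n, v != 0 -> 0 < (v^T *m S *m v) 0 0).

Definition gaussian (R : realType) (n : nat) (m : 'cV[R]_n) (S : 'M[R]_n)
    (x : 'cV[R]_n) : R :=
  (2 * pi) `^ (- (n%:R / 2)) * (\det S) `^ (- (1 / 2)) *
  expR (- (1 / 2) * ((x - m)^T *m invmx S *m (x - m)) 0 0).

(* A point of the ambient space of the parameters; the constraints cutting out
   the parameter space are in [gmm_valid]. *)
Record gmm_param (R : realType) (n : nat) := GmmParam {
  weight : R;
  mean1 : 'cV[R]_n;
  mean2 : 'cV[R]_n;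
  cov1 : 'M[R]_n;
  cov2 : 'M[R]_n }.

Definition gmm_valid (R : realType) (n : nat) (p : gmm_param R n) : Prop :=
  [/\ 0 <= weight p <= 1, posdefmx (cov1 p) & posdefmx (cov2 p)].

Definition gmm_density (R : realType) (n : nat) (p : gmm_param R n)
    (x : 'cV[R]_n) : R :=
  weight p * gaussian (mean1 p) (cov1 p) x +
  (1 - weight p) * gaussian (mean2 p) (cov2 p) x.

Definition loglik (R : realType) (n N : nat) (x : 'I_N -> 'cV[R]_n)
    (p : gmm_param R n) : R :=
  \sum_(i < N) ln (gmm_density p (x i)).

(* The direction of the coordinate S_ij = S_ji in the space of symmetric
   matrices: the two entries vary simultaneously when i != j. *)
Definition sym_dir (R : realType) (n : nat) (i j : 'I_n) : 'M[R]_n :=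
  \matrix_(k, l) (((k == i) && (l == j)) || ((k == j) && (l == i)))%:R.

(* Each conjunct says that a partial derivative of the log-likelihood exists
   and is zero, as the derivative at t = 0 along a coordinate direction. *)
Definition critical_point (R : realType) (n N : nat) (x : 'I_N -> 'cV[R]_n)
    (p : gmm_param R n) : Prop :=
  let: GmmParam a m1 m2 S1 S2 := p in
  let stationary (path : R -> gmm_param R n) : Prop :=
    is_derive (0 : R) (1 : R) (fun t : R => loglik x (path t)) (0 : R) in
  gmm_valid p /\
  [/\ stationary (fun t => GmmParam (a + t) m1 m2 S1 S2),
      forall i : 'I_n,
        stationary (fun t => GmmParam a (m1 + t *: delta_mx i 0) m2 S1 S2),
      forall i : 'I_n,
        stationary (fun t => GmmParam a m1 (m2 + t *: delta_mx i 0) S1 S2),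
      forall i j : 'I_n,
        stationary (fun t => GmmParam a m1 m2 (S1 + t *: sym_dir R i j) S2) &
      forall i j : 'I_n,
        stationary (fun t => GmmParam a m1 m2 S1 (S2 + t *: sym_dir R i j))].

(* The mixture is an honest one: its distribution is not Gaussian. *)
Definition nontrivial (R : realType) (n : nat) (p : gmm_param R n) : Prop :=
  ~ exists (m : 'cV[R]_n) (S : 'M[R]_n),
      posdefmx S /\ (forall x : 'cV[R]_n, gmm_density p x = gaussian m S x).

Definition nontrivial_critical_point (R : realType) (n N : nat)
    (x : 'I_N -> 'cV[R]_n) (p : gmm_param R n) : Prop :=
  critical_point x p /\ nontrivial p.

(* For n = 1 the coordinate cov1 p 0 0 is the variance, i.e. the square of the
   standard deviation; one is algebraic exactly when the other is. *)
Definition coordinate (R : realType) (n : nat) (p : gmm_param R n) (z : R) :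
    Prop :=
  [\/ z = weight p,
      exists i : 'I_n, z = mean1 p i 0 \/ z = mean2 p i 0 |
      exists i j : 'I_n, z = cov1 p i j \/ z = cov2 p i j].

Definition transcendental (R : realType) (z : R) : Prop :=
  ~ algebraicOver (ratr : rat -> R) z.

(* Main.v *)
(* The sample lives on the vertices of the cross-polytope and the origin, so
   the indicator of each sample point is, on the sample, a diagonal quadratic
   polynomial.  At a critical point the first two moments of the sample,
   weighted by the posterior probabilities, are rational expressions in the
   parameters, hence so are the posterior probabilities themselves.  If all
   parameters are algebraic, then so is the squared ratio of the two Gaussian
   densities at each sample point, which is an algebraic number times [expR u]
   with [u] real algebraic.  By the Hermite-Lindemann theorem [u = 0], the
   density ratio is constant on the sample, and the two components coincide.

   For the Hermite-Lindemann theorem at a real [x > 0], let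
   [E z = \sum_(j <= m) P_j(z) expR (j z)], with [deg P_j <= nu] and rational
   coefficients, be the solution of [\prod_j (d/dz - j)^nu E = 1] obtained by
   solving the factors one at a time with vanishing initial value (a
   Hermite-Pade approximant of type I).  It is positive for [z > 0], so no zero
   estimate is needed, and at most [expR (m z) z^N / N!] with
   [N = (m + 1) nu].  If [x] and [expR x] are both algebraic, then a Liouville
   inequality in the number field they generate bounds [E x] from below; if
   [m] is at least the degree of the field, this fails as [nu] grows.

   A non-trivial critical point is found among the mixtures with weight [1 / 2],
   opposite means on the first axis and equal diagonal covariances: there the
   critical equations reduce to one equation in one unknown, solved by the
   intermediate value theorem. *)
Require Import Defs.
From mathcomp Require Import all_boot all_order all_algebra.
From mathcomp Require Import perm separable.
From mathcomp Require Import all_classical all_reals all_analysis.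
From mathcomp Require Import ring lra.

Set Implicit Arguments.
Unset Strict Implicit.
Unset Printing Implicit Defensive.

Import Order.TTheory GRing.Theory Num.Theory.
Import numFieldNormedType.Exports.

Local Open Scope ring_scope.

(** * Exponential polynomials in the divided power basis *)

(* A list [s] stands for [\sum_i s`_i x^i / i!], so that [behead] is the
   derivative; [solve d s] is then the polynomial solution [B] of
   [B' + d B = s]. *)
Fixpoint solve (d : rat) (s : seq rat) : seq rat :=
  if s is a :: s' then
    let t := solve d s' in (a - head 0 t) / d :: t
  else [::].

Lemma size_solve d s : size (solve d s) = size s.
Proof. by elim: s => //= a s ->. Qed.

Lemma solveE d s i : d != 0 ->
  (behead (solve d s))`_i + d * (solve d s)`_i = s`_i.
Proof.
move=> d0; elim: s i => [|a s IH] i /=; first by rewrite !nth_nil mulr0 addr0.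
case: i => [|i] /=; first by rewrite mulrC divfK // nth0 addrC subrK.
by rewrite -nth_behead IH.
Qed.

(** The solution has coefficients [B_i = \sum_k (-1)^k s_(i+k) / d^(k+1)]. Dividing the coefficient
    of index [i + k] by [L^(i+k)] leaves [L^k] to absorb [d^k], so each equation solved costs a
    single factor [L], whatever the degree. *)
Lemma solve_int d s (L r : rat) : L != 0 -> L / d \is a Num.int ->
  (forall i, r * s`_i / L ^+ i \is a Num.int) ->
  forall i, r * L * (solve d s)`_i / L ^+ i \is a Num.int.
Proof.
move=> L0 Ld; elim: s r => [|a s IH] r H i /=.
  by rewrite !nth_nil mulr0 mul0r rpred0.
have Hs j : r / L * s`_j / L ^+ j \is a Num.int.
  have := H j.+1; rewrite /= exprS invfM.
  by congr (_ \is a _); ring.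
have {}IH := IH _ Hs; case: i => [|i] /=; last first.
  have := IH i; rewrite divfK // exprS.
  by congr (_ \is a _); field; rewrite L0 expf_neq0.
rewrite expr0 divr1.
have -> : r * L * ((a - head 0 (solve d s)) / d) =
    L / d * (r * a - r * head 0 (solve d s)) by ring.
apply: rpredM => //; apply: rpredB; first by have := H 0; rewrite /= divr1.
by have := IH 0; rewrite divfK // expr0 divr1 nth0.
Qed.

(** With the weight [2^i] and [|d| >= 1], the series for [B_i] is dominated by a geometric series of
    ratio 1/2, whose sum gives the factor 2. *)
Lemma solve_bound d s (X : rat) : 1 <= `|d| ->
  (forall i, `|s`_i| * 2 ^+ i <= X) ->
  forall i, `|(solve d s)`_i| * 2 ^+ i <= 2 * X.
Proof.
move=> d1; elim: s X => [|a s IH] X H i /=.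
  have := H 0; rewrite !nth_nil normr0 !mul0r => X0; lra.
have Hs j : `|s`_j| * 2 ^+ j <= X / 2.
  by have := H j.+1; rewrite /= exprS => h; lra.
have {}IH := IH _ Hs; case: i => [|i] /=.
  rewrite expr0 mulr1 normrM normfV ler_pdivrMr ?(lt_le_trans ltr01) //.
  have h0 := H 0; have h1 := IH 0; rewrite /= expr0 mulr1 nth0 in h0 h1.
  have h2 := ler_normB a (head 0 (solve d s)).
  have X0 : 0 <= X by apply: le_trans h0.
  have h3 : 2 * X <= 2 * X * `|d| by rewrite ler_peMr // mulr_ge0.
  by lra.
have := IH i; rewrite exprS => h; lra.
Qed.

(** Inverts [d/dz - k] on [\sum_(j <= m) c_j(z) exp(j z)] with value 0 at the origin. For [j != k]
    the new polynomial solves [B' + (j - k) B = c_j]. For [j = k] it is a primitive of [c_k], which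
    in divided powers is a shift, and its free constant term enforces the initial value. *)
Definition opstep (m k : nat) (c : nat -> seq rat) (j : nat) : seq rat :=
  if j == k then
    - (\sum_(i < m.+1 | i != k :> nat) head 0 (solve (i%:R - k%:R) (c i))) :: c k
  else solve (j%:R - k%:R) (c j).

(** Coefficients of the type I approximant: starting from the constant 1, one operator [d/dz - k] is
    inverted for each [k] in the list. *)
Fixpoint expform (m : nat) (s : seq nat) : nat -> seq rat :=
  if s is k :: s' then opstep m k (expform m s')
  else fun j => if j == 0%N then [:: 1] else [::].

Lemma size_expform m s j : size (expform m s j) = ((j == 0) + count_mem j s)%N.
Proof.
elim: s => [|k s IH] /=; first by case: (j == 0%N).
rewrite /opstep; have [jk|jk] := eqVneq j k; last by rewrite size_solve IH.
by rewrite /= -jk IH add1n addnS.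
Qed.

Lemma fact_divr_int (m j k : nat) : (j <= m)%N -> (k <= m)%N -> j != k ->
  (m`!%:R / (j%:R - k%:R) : rat) \is a Num.int.
Proof.
move=> jm km; wlog kj : j k jm km / (k < j)%N => [hw|] jk.
  have /orP[kj|kj] : (k < j)%N || (j < k)%N by rewrite -neq_ltn eq_sym.
    exact: hw.
  by rewrite -opprB invrN mulrN rpredN hw // eq_sym.
rewrite -natrB ?(ltnW kj) //.
have /dvdnP[q ->] : (j - k %| m`!)%N.
  by rewrite dvdn_fact // subn_gt0 kj (leq_trans (leq_subr _ _)).
by rewrite natrM mulfK ?rpred_nat // pnatr_eq0 subn_eq0 -ltnNge.
Qed.

Lemma expform_int m s j i : all (fun k => k <= m)%N s -> (j <= m)%N ->
  m`!%:R ^+ size s * (expform m s j)`_i / m`!%:R ^+ i \is a Num.int.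
Proof.
have L0 : m`!%:R != 0 :> rat by rewrite pnatr_eq0 -lt0n fact_gt0.
elim: s j i => [|k s IH] j i /=.
  move=> _ _; rewrite expr0 mul1r; case: (j == 0%N); last first.
    by rewrite nth_nil mul0r rpred0.
  by case: i => [|i]; rewrite /= ?expr0 ?divr1 // ?nth_nil mul0r rpred0.
move=> /andP[km sm] jm.
have solveI a b : (a <= m)%N -> a != k ->
    m`!%:R ^+ (size s).+1 * (solve (a%:R - k%:R) (expform m s a))`_b
      / m`!%:R ^+ b \is a Num.int.
  move=> am ak; rewrite exprSr; apply: solve_int => // [|b'].
    exact: fact_divr_int.
  exact: IH.
rewrite /opstep; case: eqVneq => [_|jk]; last exact: solveI.
(* Integration raises each index by one, and the new factor [L] of this step pays for the extra
   power of [L] in the denominator. *)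
case: i => [|i] /=; last first.
  rewrite !exprS; have := IH k i sm km.
  by congr (_ \is a _); field; rewrite L0 expf_neq0.
rewrite expr0 divr1 mulrN rpredN mulr_sumr rpred_sum // => a ak.
by have := solveI a 0%N; rewrite expr0 divr1 nth0; apply => //; rewrite -ltnS.
Qed.

Lemma normr_natrB_ge1 (j k : nat) : j != k -> (1 : rat) <= `|j%:R - k%:R|.
Proof.
wlog kj : j k / (k < j)%N => [hw|] jk.
  have /orP[kj|kj] : (k < j)%N || (j < k)%N by rewrite -neq_ltn eq_sym.
    exact: hw.
  by rewrite distrC hw // eq_sym.
rewrite -natrB ?(ltnW kj) // normr_nat.
by rewrite (ler_nat _ 1) subn_gt0.
Qed.

(** The factor [2 (m + 1)] per operator covers every case: solving doubles the bound, the shift by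
    one index doubles the weight [2^i], and the new constant term is a sum of at most [m] solutions,
    each bounded by [2 X]. *)
Lemma expform_bound m s j i : all (fun k => k <= m)%N s -> (j <= m)%N ->
  `|(expform m s j)`_i| * 2 ^+ i <= (2 * m.+1%:R) ^+ size s.
Proof.
have m1 : (1 : rat) <= m.+1%:R by rewrite (ler_nat _ 1).
elim: s j i => [|k s IH] j i /=.
  move=> _ _; rewrite expr0; case: (j == 0%N); last first.
    by rewrite nth_nil normr0 mul0r ler01.
  case: i => [|i] /=; first by rewrite normr1 mul1r expr0 lexx.
  by rewrite nth_nil normr0 mul0r ler01.
move=> /andP[km sm] jm; set X := _ ^+ _ in IH *.
have X0 : 0 <= X by rewrite exprn_ge0 // mulr_ge0 // ler0n.
have solveB a b : (a <= m)%N -> a != k ->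
    `|(solve (a%:R - k%:R) (expform m s a))`_b| * 2 ^+ b <= 2 * X.
  move=> am ak; apply: solve_bound => [|b']; first exact: normr_natrB_ge1.
  exact: IH.
have XX : 2 * X <= 2 * m.+1%:R * X.
  by rewrite mulrAC ler_peMr // mulr_ge0.
rewrite exprS -/X /opstep; case: eqVneq => [_|jk]; last first.
  exact: le_trans (solveB _ _ jm jk) XX.
case: i => [|i] /=.
  rewrite expr0 mulr1 normrN (le_trans (ler_norm_sum _ _ _)) //.
  apply: (@le_trans _ _ (\sum_(a < m.+1) 2 * X)).
    rewrite [leRHS](bigID (fun a : 'I_m.+1 => a != k :> nat)) /=.
    rewrite -[leLHS]addr0 lerD ?sumr_ge0 // => [|a _]; last by rewrite mulr_ge0.
    apply: ler_sum => a ak.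
    by have := solveB a 0%N; rewrite expr0 mulr1 nth0; apply => //; rewrite -ltnS.
  rewrite sumr_const card_ord -mulr_natr le_eqVlt; apply/orP; left.
  by apply/eqP; ring.
by rewrite (le_trans _ XX) // exprS mulrCA ler_pM2l // IH.
Qed.

(** * Derivative rules for real functions of one variable *)

Section RealDerivatives.
Variable R : realType.
Implicit Types (f g : R -> R) (x df dg : R).

Lemma is_derive1M f g x df dg :
  is_derive x (1 : R) f df -> is_derive x (1 : R) g dg ->
  is_derive x (1 : R) (fun t => f t * g t) (df * g x + f x * dg).
Proof.
move=> fd gd; apply: (is_derive_eq (is_deriveM fd gd)).
by rewrite /GRing.scale /= addrC mulrC.
Qed.

Lemma is_derive1Ml (a : R) f x df : is_derive x (1 : R) f df ->
  is_derive x (1 : R) (fun t => a * f t) (a * df).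
Proof. exact: is_deriveZ. Qed.

Lemma is_derive1_expR f x df : is_derive x (1 : R) f df ->
  is_derive x (1 : R) (fun t => expR (f t)) (expR (f x) * df).
Proof. by move=> fd; apply: is_derive1_comp. Qed.

Lemma is_derive1_id x : is_derive x (1 : R) (fun t : R => t) 1.
Proof. exact: is_derive_id. Qed.

Lemma is_derive1_sum n (h : 'I_n -> R -> R) x (dh : 'I_n -> R) :
  (forall i, is_derive x (1 : R) (h i) (dh i)) ->
  is_derive x (1 : R) (fun t => \sum_(i < n) h i t) (\sum_(i < n) dh i).
Proof.
have -> : (fun t => \sum_(i < n) h i t) = \sum_(i < n) h i.
  by apply/funext => t; rewrite fct_sumE.
exact: is_derive_sum.
Qed.

Lemma is_derive1X f n x df : is_derive x (1 : R) f df ->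
  is_derive x (1 : R) (fun t => f t ^+ n) (n%:R * f x ^+ n.-1 * df).
Proof.
have -> : (fun t => f t ^+ n) = f ^+ n by apply/funext => t; rewrite exprfctE.
by move=> fd; apply: is_deriveX.
Qed.

End RealDerivatives.

(** The mean value theorem for [exp(- k t) y(t)] replaces the variation of constants integral. It is
    used to pass the sign of the forcing term [f] on to [y]. *)
Lemma linear_ode_mvt (R : realType) (y f : R -> R) (k x : R) :
  (forall t, is_derive (t : R) (1 : R) y (k * y t + f t)) -> y 0 = 0 -> 0 < x ->
  exists2 c, 0 < c < x & y x = expR (k * (x - c)) * f c * x.
Proof.
move=> yd y0 x0.
pose g t := expR (- k * t) * y t.
have gd t : is_derive t (1 : R) g (expR (- k * t) * f t).
  have ed := is_derive1_expR (is_derive1Ml (- k) (is_derive1_id t)).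
  by apply: (is_derive_eq (is_derive1M ed (yd t))) => /=; ring.
have gc : {within `[0, x], continuous g}%classic.
  by apply: derivable_within_continuous => t _; case: (gd t).
have [c cx] := MVT x0 (fun t _ => gd t) gc.
rewrite /g y0 mulr0 !subr0 => H; exists c; first by rewrite in_itv in cx.
apply: (@mulfI _ (expR (- k * x))); first by rewrite gt_eqF ?expR_gt0.
by rewrite H !mulrA -expRD; congr (expR _ * _ * _); ring.
Qed.

(** * Exponential polynomials as real functions: positivity and size of the approximant *)

Definition dpoly (R : realType) (s : seq rat) : {poly R} :=
  \poly_(i < size s) (ratr s`_i / i`!%:R).

Lemma coef_dpoly (R : realType) s i : (dpoly R s)`_i = ratr s`_i / i`!%:R.
Proof.
by rewrite coef_poly; case: ltnP => // h; rewrite nth_default // rmorph0 mul0r.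
Qed.

Lemma deriv_dpoly (R : realType) s : (dpoly R s)^`() = dpoly R (behead s).
Proof.
apply/polyP => i; rewrite coef_deriv !coef_dpoly nth_behead factS natrM.
by rewrite -mulr_natr; field; rewrite nat1r !pnatr_eq0 -lt0n fact_gt0.
Qed.

Lemma dpoly_solve (R : realType) d s : d != 0 ->
  dpoly R (behead (solve d s)) + ratr d *: dpoly R (solve d s) = dpoly R s.
Proof.
move=> d0; apply/polyP => i; rewrite coefD coefZ !coef_dpoly mulrA -mulrDl.
by rewrite -rmorphM -rmorphD /= solveE.
Qed.

Lemma horner0_dpoly (R : realType) s : (dpoly R s).[0] = ratr (head 0 s).
Proof. by rewrite horner_coef0 coef_dpoly divr1 nth0. Qed.

Definition expeval (R : realType) (m : nat) (c : nat -> seq rat) (x : R) : R :=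
  \sum_(j < m.+1) (dpoly R (c j)).[x] * expR (j%:R * x).

Lemma is_derive_expeval (R : realType) m c (x : R) :
  is_derive x (1 : R) (expeval m c)
    (\sum_(j < m.+1) ((dpoly R (behead (c j))).[x] +
                     j%:R * (dpoly R (c j)).[x]) * expR (j%:R * x)).
Proof.
apply: is_derive1_sum => j.
have ed := is_derive1_expR (is_derive1Ml j%:R (is_derive1_id x)).
apply: (is_derive_eq (is_derive1M (is_derive_poly _ x) ed)).
by rewrite deriv_dpoly /=; ring.
Qed.

Lemma is_derive_expeval_opstep (R : realType) m k c (x : R) : (k <= m)%N ->
  is_derive x (1 : R) (expeval m (opstep m k c))
    (k%:R * expeval m (opstep m k c) x + expeval m c x).
Proof.
move=> km; apply: is_derive_eq; first exact: is_derive_expeval.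
rewrite /expeval mulr_sumr -big_split; apply: eq_bigr => j _ /=.
rewrite /opstep; case: eqVneq => [jk|jk] /=; first by rewrite jk; ring.
rewrite -[in RHS](dpoly_solve R (c j) (d := j%:R - k%:R)); last first.
  by rewrite subr_eq0 eqr_nat.
by rewrite hornerD hornerZ rmorphB /= !ratr_nat; ring.
Qed.

Lemma expeval_opstep0 (R : realType) m k c : (k <= m)%N ->
  expeval m (opstep m k c) (0 : R) = 0.
Proof.
move=> km; rewrite /expeval.
under eq_bigr do rewrite mulr0 expR0 mulr1 horner0_dpoly.
rewrite -rmorph_sum /= (bigD1 (Ordinal (km : k < m.+1)%N)) //=.
rewrite {1}/opstep eqxx /= addrC.
rewrite (eq_bigr (fun j : 'I_m.+1 => head 0 (solve (j%:R - k%:R) (c j)))).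
  by rewrite subrr rmorph0.
by move=> j jk; rewrite /opstep ifN.
Qed.

(** Induction on the operators, each bound passing through the sign of a forcing term. Positivity is
    immediate from the equation [y' = k y + E] with [E > 0]; for the upper bound the same argument
    is applied to majorant minus [y]. *)
Lemma expeval_expform (R : realType) m s (x : R) :
  all (fun k => k <= m)%N s -> 0 < x ->
  0 < expeval m (expform m s) x <=
    expR (m%:R * x) * x ^+ size s / (size s)`!%:R.
Proof.
elim: s x => [|k s IH] x /=.
  move=> _ x0; rewrite /expeval big_ord_recl big1 => [|j _]; last first.
    by rewrite /dpoly /= poly_def big_ord0 horner0 mul0r.
  rewrite /dpoly /= poly_def big_ord1 /= rmorph1 expr0 !mul0r expR0 addr0.
  rewrite hornerZ hornerC !mulr1 invr1 !mulr1 ltr01.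
  by rewrite -expR0 ler_expR mulr_ge0 // ltW.
move=> /andP[km sm] x0.
have ed t := @is_derive_expeval_opstep R m k (expform m s) t km.
have y0 := expeval_opstep0 R (expform m s) km.
apply/andP; split.
  have [c /andP[c0 _] ->] := linear_ode_mvt ed y0 x0.
  by rewrite !mulr_gt0 ?expR_gt0 //; case/andP: (IH c sm c0).
set y := expeval m _ in ed y0 *.
pose P t : R := expR (m%:R * t) * t ^+ (size s).+1 / (size s).+1`!%:R.
pose p t : R := expR (m%:R * t) * t ^+ size s / (size s)`!%:R.
have Pd (t : R) : is_derive t (1 : R) P (m%:R * P t + p t).
  have ed1 := is_derive1_expR (is_derive1Ml m%:R (is_derive1_id t)).
  have Xd : is_derive t (1 : R) (fun t => t ^+ (size s).+1)
      ((size s).+1%:R * t ^+ size s).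
    by apply: (is_derive_eq (is_derive1X _ (is_derive1_id t))); rewrite mulr1.
  have := is_derive1M (is_derive1M ed1 Xd) (is_derive_cst ((size s).+1`!%:R^-1 : R) t 1).
  move=> h; apply: (is_derive_eq h).
  rewrite /P /p /= factS natrM; field.
  by rewrite nat1r !pnatr_eq0 -lt0n fact_gt0.
(* Since [P' = m P + p], the difference satisfies [z' = k z + ((m - k) P + p - E)], whose forcing
   term is nonnegative because [k <= m] and [E <= p] by induction. *)
pose z t := P t - y t.
have zd (t : R) : is_derive t (1 : R) z
    (k%:R * z t + ((m%:R - k%:R) * P t + p t - expeval m (expform m s) t)).
  by apply: (is_derive_eq (is_deriveB (Pd t) (ed t))); rewrite /z -/y; ring.
have z0 : z 0 = 0 by rewrite /z y0 /P expr0n mulr0 mul0r subrr.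
have [c /andP[c0 _] zx] := linear_ode_mvt zd z0 x0.
rewrite -subr_ge0 -/(P x) -/(z x) zx.
apply: mulr_ge0 (ltW x0); apply: mulr_ge0; first exact: expR_ge0.
rewrite -addrA addr_ge0 //.
  rewrite !mulr_ge0 ?expR_ge0 ?invr_ge0 ?exprn_ge0 // ?(ltW c0) //.
  by rewrite subr_ge0 ler_nat.
by rewrite subr_ge0; case/andP: (IH c sm c0).
Qed.

(** * A Liouville inequality *)

Lemma ex_min_annihilator (R : realType) (z : R) :
  algebraicOver (ratr : rat -> R) z ->
  exists2 q : {poly rat}, (1 < size q)%N && root (map_poly ratr q) z &
    forall r : {poly rat}, (size r < size q)%N -> root (map_poly ratr r) z ->
      r = 0.
Proof.
move=> [p p0 pz].
pose P n := `[< exists q : {poly rat},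
  [/\ q != 0, size q = n & root (map_poly ratr q) z] >].
have exP : exists n, P n by exists (size p); apply/asboolP; exists p.
case: (ex_minnP exP) => n /asboolP[q [q0 qn qz]] nmin; exists q.
  rewrite qz andbT ltn_neqAle size_poly_gt0 q0 andbT eq_sym.
  apply/negP => /size_poly1P[c c0 qc]; move: qz.
  by rewrite qc map_polyC rootC /= fmorph_eq0 (negPf c0).
move=> r rq rz; apply/eqP; apply: contraT => r0.
by rewrite qn ltnNge nmin // in rq; apply/asboolP; exists r.
Qed.

(** The entries of [v] are the powers of [z], a basis of [Q(z)] over [Q]. Multiplication by an
    element of [Q(z)] has a rational matrix in this basis, with [v] as eigenvector. *)
Lemma rational_eigenvector (R : realType) (z : R) :
  algebraicOver (ratr : rat -> R) z ->
  exists (d : nat) (v : 'cV[R]_d.+1),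
  [/\ v 0 0 = 1,
      forall u : 'rV[rat]_d.+1, map_mx ratr u *m v = 0 -> u = 0 &
      forall g : {poly rat}, exists A : 'M[rat]_d.+1,
        map_mx ratr A *m v = (map_poly ratr g).[z] *: v].
Proof.
move=> /ex_min_annihilator[q /andP[q1 qz] qmin].
have [d qd] : exists d, size q = d.+2.
  by case: (size q) q1 => [|[|d]] // _; exists d.
have vE (h : {poly rat}) : (size h < d.+2)%N ->
    \sum_(j < d.+1) ratr h`_j * z ^+ j = (map_poly ratr h).[z].
  move=> hd; rewrite (@horner_coef_wide _ d.+1) ?size_map_poly //.
  by apply: eq_bigr => j _; rewrite coef_map.
exists d, (\col_i z ^+ i); split.
- by rewrite mxE expr0.
- move=> u /matrixP/(_ 0 0); rewrite !mxE => u0.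
  have su : (size (rVpoly u) < d.+2)%N by rewrite ltnS size_poly.
  suff: rVpoly u = 0 by move=> /(congr1 (@poly_rV _ d.+1)); rewrite rVpolyK linear0.
  apply: qmin; rewrite ?qd // /root -vE // -[X in _ == X]u0; apply/eqP.
  by apply: eq_bigr => j _; rewrite !mxE coef_rVpoly_ord.
(* Row [i] holds the coefficients of [g X^i] reduced modulo the minimal polynomial of [z]. *)
- move=> g; exists (\matrix_(i, j) ((g * 'X^i) %% q)`_j).
  apply/colP => i; rewrite !mxE.
  under eq_bigr do rewrite !mxE.
  have q0 : q != 0 by rewrite -size_poly_gt0 qd.
  rewrite vE; last by rewrite -qd ltn_modp.
  have := congr1 (fun h => (map_poly ratr h).[z]) (divp_eq (g * 'X^i) q).
  rewrite rmorphD !rmorphM /= hornerD !hornerM (rootP qz) mulr0 add0r => <-.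
  by rewrite map_polyXn hornerXn.
Qed.

(** The determinant plays the role of a norm. If [u P = 0], then [w (u v) = u P v = 0], so
    [u v = 0], and the rational independence of the entries of [v] gives [u = 0]. *)
Lemma det_neq0_of_eigen (R : realType) d (v : 'cV[R]_d.+1) (P : 'M[rat]_d.+1)
    (w : R) :
  (forall u : 'rV[rat]_d.+1, map_mx ratr u *m v = 0 -> u = 0) ->
  map_mx ratr P *m v = w *: v -> w != 0 -> \det P != 0.
Proof.
move=> vfree Pv w0; apply/negP => /det0P[u u0 uP].
case/negP: u0; apply/eqP/vfree/(scalerI w0).
by rewrite scaler0 scalemxAr -Pv mulmxA -map_mxM uP map_mx0 mul0mx.
Qed.

Lemma ex_common_denominator (I : finType) (f : I -> rat) :
  exists2 b : nat, (0 < b)%N & forall i, b%:R * f i \is a Num.int.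
Proof.
exists (\prod_i `|denq (f i)|)%N; first by rewrite prodn_gt0 // => i; rewrite absz_gt0 denq_neq0.
move=> i; rewrite (bigD1 i) //= natrM mulrAC rpredM ?rpred_nat //.
have -> : (`|denq (f i)|%N%:R : rat) = (denq (f i))%:~R.
  by rewrite pmulrn abszE gtr0_norm ?denq_gt0.
by rewrite mulrC -numqE rpred_int.
Qed.

(** By the primitive element theorem [x] and [y] are polynomials in one algebraic [z], so their
    multiplication matrices share the eigenvector [v]; [b] is a common denominator of the two
    matrices. *)
Lemma integral_eigenvector (R : realType) (x y : R) :
  algebraicOver (ratr : rat -> R) x -> algebraicOver (ratr : rat -> R) y ->
  exists (d b : nat) (A B : 'M[int]_d.+1) (v : 'cV[R]_d.+1),
  [/\ (0 < b)%N /\ v 0 0 = 1,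
      map_mx intr A *m v = (b%:R * x) *: v,
      map_mx intr B *m v = (b%:R * y) *: v &
      forall (P : 'M[int]_d.+1) (w : R), map_mx intr P *m v = w *: v ->
        w != 0 -> \det P != 0].
Proof.
move=> xalg yalg; case: (xalg) (yalg) => [p p0 px] [r r0 ry].
have [|n [[g gx] [h hy]]] := pchar0_PET p0 px r0 ry.
  exact: pchar_num.
set z := _ - _ in gx hy.
have zalg : algebraicOver (ratr : rat -> R) z.
  apply: algebraic_sub => //; rewrite -mulr_natr; apply: algebraic_mul => //.
  by rewrite -(ratr_nat R n); exact: algebraic_id.
have [d [v [v1 vfree vev]]] := rational_eigenvector zalg.
have [A Av] := vev g; have [B Bv] := vev h.
rewrite gx in Av; rewrite hy in Bv.
have [b b0 bint] := ex_common_denominator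
  (fun k : ('I_d.+1 * 'I_d.+1) * bool => (if k.2 then A else B) k.1.1 k.1.2).
have lift (M : 'M[rat]_d.+1) : (forall i j, b%:R * M i j \is a Num.int) ->
    exists M' : 'M[int]_d.+1, map_mx intr M' = b%:R *: M.
  move=> Mi; exists (\matrix_(i, j) Num.floor (b%:R * M i j)).
  by apply/matrixP => i j; rewrite !mxE floorK.
have [A' A'E] := lift A (fun i j => bint ((i, j), true)).
have [B' B'E] := lift B (fun i j => bint ((i, j), false)).
have ratrZ (M : 'M[int]_d.+1) : map_mx intr M = map_mx ratr (map_mx intr M : 'M[rat]_d.+1) :> 'M[R]_d.+1.
  by apply/matrixP => i j; rewrite !mxE ratr_int.
exists d, b, A', B', v; split => //.
- by rewrite ratrZ A'E map_mxZ /= ratr_nat -scalemxAl Av scalerA.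
- by rewrite ratrZ B'E map_mxZ /= ratr_nat -scalemxAl Bv scalerA.
- move=> P w; rewrite ratrZ => Pv w0; have := det_neq0_of_eigen vfree Pv w0.
  by rewrite det_map_mx intr_eq0.
Qed.

Lemma det_le (R : realDomainType) d (M : 'M[R]_d) (X : R) :
  (forall i j, `|M i j| <= X) -> `|\det M| <= d`!%:R * X ^+ d.
Proof.
move=> MX; apply: le_trans (ler_norm_sum _ _ _) _.
apply: (@le_trans _ _ (\sum_(s : 'S_d) X ^+ d)).
  apply: ler_sum => s _; rewrite normrM normr_sign mul1r normr_prod.
  rewrite -[d in X in _ <= X]card_ord -prodr_const.
  by apply: ler_prod => i _; rewrite normr_ge0 MX.
by rewrite sumr_const card_Sn mulr_natl.
Qed.

Lemma mulmx_pow_le (R : realDomainType) d (A M : 'M[R]_d.+1) (a c : R) k :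
  (forall i j, `|A i j| * d.+1%:R <= a) -> (forall i j, `|M i j| <= c) ->
  forall i j, `|(A ^+ k * M) i j| <= a ^+ k * c.
Proof.
move=> Aa Mc; elim: k => [|k IH] i j; first by rewrite !expr0 !mul1r.
rewrite !exprS -!mulrA mxE; apply: le_trans (ler_norm_sum _ _ _) _.
have a0 : 0 <= a by rewrite (le_trans _ (Aa 0 0)) // mulr_ge0.
have ac0 : 0 <= a ^+ k * c.
  by rewrite mulr_ge0 ?exprn_ge0 // (le_trans _ (Mc 0 0)).
rewrite -(@ler_pM2r _ d.+1%:R) ?ltr0n // mulr_suml.
apply: (@le_trans _ _ (\sum_(l < d.+1) a * (a ^+ k * c))).
  apply: ler_sum => l _; rewrite normrM mulrAC; exact: ler_pM.
by rewrite sumr_const card_ord mulr_natr.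
Qed.

Lemma expmx_eigen (R : comNzRingType) d (A : 'M[R]_d.+1) (v : 'cV[R]_d.+1) c k :
  A *m v = c *: v -> A ^+ k *m v = c ^+ k *: v.
Proof.
move=> Av; elim: k => [|k IH]; first by rewrite !expr0 mul1mx scale1r.
by rewrite exprS exprSr -mulmxE -mulmxA IH -scalemxAr Av scalerA.
Qed.

Lemma natrS_le_exp2 (R : realDomainType) n : (n.+1%:R : R) <= 2 ^+ n.
Proof. by rewrite -natrX ler_nat ltn_expl. Qed.

(** An integer matrix [P] has [v] as eigenvector for [b^(m+n) z], so its determinant is a nonzero
    integer. Multiplying by the adjugate bounds this determinant by the eigenvalue times minors of
    size [d]. The matrix has size [d + 1], and this drop by one is why [H] occurs only to the power
    [d]. *)
Lemma liouville (R : realType) (x y : R) :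
  algebraicOver (ratr : rat -> R) x -> algebraicOver (ratr : rat -> R) y ->
  exists (d : nat) (C : R), 1 <= C /\
    forall (m n : nat) (p : 'I_m.+1 -> 'I_n.+1 -> int) (H : R),
      (forall i j, `|(p i j)%:~R| <= H) ->
      let z := \sum_i \sum_j (p i j)%:~R * x ^+ i * y ^+ j in
      z != 0 -> 1 <= `|z| * C ^+ (m + n).+1 * H ^+ d.
Proof.
move=> xalg yalg.
have [d [b [A [B [v [[b0 v0] Ax By Pdet]]]]]] := integral_eigenvector xalg yalg.
have ub (I : finType) (f : I -> R) : exists2 a : R, 1 <= a & forall i, `|f i| <= a.
  exists (1 + \sum_i `|f i|); first by rewrite lerDl sumr_ge0.
  move=> i; rewrite (bigD1 i) //= addrCA lerDl addr_ge0 // sumr_ge0 //.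
have [a a1 ab] := ub _ (fun k : ('I_d.+1 * 'I_d.+1) * bool =>
  (if k.2 then map_mx intr A else map_mx intr B : 'M[R]_d.+1) k.1.1 k.1.2 *
   d.+1%:R).
have Aa i j : `|(map_mx intr A : 'M[R]_d.+1) i j| * d.+1%:R <= a.
  by have := ab ((i, j), true); rewrite normrM normr_nat.
have Ba i j : `|(map_mx intr B : 'M[R]_d.+1) i j| * d.+1%:R <= a.
  by have := ab ((i, j), false); rewrite normrM normr_nat.
have [V V1 vV] := ub _ (fun i => v i 0).
pose K : R := V * d.+1%:R * d`!%:R.
have K1 : 1 <= K.
  rewrite /K -mulrA -[leLHS]mulr1 ler_pM // -[leLHS]mulr1.
  by rewrite ler_pM // ler1n ?fact_gt0.
exists d, (K * (b%:R * (2 * (b%:R * a)) ^+ d)); split.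
  have b1 : 1 <= b%:R :> R by rewrite ler1n.
  have ba1 : 1 <= 2 * (b%:R * a).
    by have := ler_pM ler01 ler01 b1 a1; lra.
  rewrite -[leLHS]mulr1 ler_pM // -[leLHS]mulr1 ler_pM //.
  exact: exprn_ege1.
move=> m n p H pH z z0.
have H0 : 0 <= H by rewrite (le_trans _ (pH ord0 ord0)).
(* The powers of [b] homogenise: [A^i B^j] already carries [b^(i+j)], and every term must reach
   [b^(m+n)]. *)
pose c (i : 'I_m.+1) (j : 'I_n.+1) : int :=
  p i j * (b ^ (m - i) * b ^ (n - j))%N%:R.
pose P : 'M[int]_d.+1 := \sum_i \sum_j c i j *: (A ^+ i * B ^+ j).
pose P' : 'M[R]_d.+1 :=
  \sum_i \sum_j (c i j)%:~R *: (map_mx intr A ^+ i * map_mx intr B ^+ j).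
have PE : map_mx intr P = P'.
  rewrite rmorph_sum; apply: eq_bigr => i _; rewrite rmorph_sum.
  apply: eq_bigr => j _; rewrite /= map_mxZ; congr (_ *: _).
  by rewrite rmorphM !rmorphXn.
have Pv : P' *m v = (b%:R ^+ (m + n) * z) *: v.
  rewrite mulr_sumr scaler_suml mulmx_suml; apply: eq_bigr => i _.
  rewrite mulr_sumr scaler_suml mulmx_suml; apply: eq_bigr => j _.
  rewrite -scalemxAl -mulmxE -mulmxA (expmx_eigen _ By) -scalemxAr.
  rewrite (expmx_eigen _ Ax) !scalerA; congr (_ *: v).
  rewrite /c rmorphM rmorph_nat natrM !natrX !exprMn.
  have -> : (m + n = (m - i) + (n - j) + (i + j))%N.
    by rewrite addnACA !subnK // -ltnS.
  by rewrite !exprD; ring.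
have b1 : 1 <= b%:R :> R by rewrite ler1n.
have a0 : 0 <= a by exact: le_trans a1.
have P'le k l : `|P' k l| <= H * (2 * (b%:R * a)) ^+ (m + n).
  have cE i j k' l' : `|(c i j)%:~R * (map_mx intr A ^+ i * map_mx intr B ^+ j) k' l'|
      <= H * (b%:R * a) ^+ (m + n).
    rewrite normrM /c rmorphM rmorph_nat normrM normr_nat -mulrA exprMn.
    apply: ler_pM => //; first exact: pH.
    have Bj (i' j' : 'I_d.+1) : `|(map_mx intr B ^+ j : 'M[R]_d.+1) i' j'| <= a ^+ j.
      rewrite -[map_mx _ _ ^+ _]mulr1 -[leRHS]mulr1; apply: mulmx_pow_le => //.
      by move=> i1 j1; rewrite mxE; case: eqP; rewrite ?normr1 ?normr0.
    apply: ler_pM => //.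
      rewrite natrM !natrX -exprD ler_weXn2l //.
      by rewrite leq_add // leq_subr.
    apply: le_trans (mulmx_pow_le _ Aa Bj k' l') _.
    by rewrite -exprD ler_weXn2l // leq_add // -ltnS.
  rewrite /P' summxE; apply: le_trans (ler_norm_sum _ _ _) _.
  apply: (@le_trans _ _ (\sum_(i < m.+1) \sum_(j < n.+1) H * (b%:R * a) ^+ (m + n))).
    apply: ler_sum => i _; rewrite summxE; apply: le_trans (ler_norm_sum _ _ _) _.
    by apply: ler_sum => j _; rewrite mxE cE.
  rewrite !sumr_const !card_ord -mulrnA -[leLHS]mulr_natl [_ ^+ _ in leRHS]exprMn [leRHS]mulrCA.
  rewrite ler_wpM2r ?mulr_ge0 ?exprn_ge0 // ?mulr_ge0 // mulnC natrM exprD.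
  by apply: ler_pM; rewrite ?natrS_le_exp2.
have detP : \det P != 0.
  apply: (Pdet P (b%:R ^+ (m + n) * z)); first by rewrite PE.
  by rewrite mulf_neq0 // expf_neq0 // pnatr_eq0 -lt0n.
have detP' : 1 <= `|\det P'|.
  rewrite -PE det_map_mx /= -intr_norm (ler_int R 1).
  by rewrite -gtz0_ge1 normr_gt0.
set X := H * _ in P'le.
have X0 : 0 <= X by rewrite mulr_ge0 ?exprn_ge0 ?mulr_ge0.
have adjle k l : `|(\adj P') k l| <= d`!%:R * X ^+ d.
  rewrite mxE normrM normrX normrN1 expr1n mul1r; apply: det_le => i j.
  by rewrite !mxE.
(* Coordinate 0 of [\adj P' *m P' *m v], where [v 0 0 = 1]. *)
have detE : \det P' = b%:R ^+ (m + n) * z * \sum_l (\adj P') 0 l * v l 0.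
  have := congr1 (mulmx (\adj P')) Pv.
  rewrite mulmxA mul_adj_mx -scalemxAr mul_scalar_mx => /matrixP/(_ 0 0).
  by rewrite !mxE v0 mulr1.
have sumle : `|\sum_l (\adj P') 0 l * v l 0| <= K * X ^+ d.
  apply: le_trans (ler_norm_sum _ _ _) _.
  apply: (@le_trans _ _ (\sum_(l < d.+1) (d`!%:R * X ^+ d) * V)).
    by apply: ler_sum => l _; rewrite normrM ler_pM.
  rewrite sumr_const card_ord -mulr_natr le_eqVlt; apply/orP; left.
  by apply/eqP; rewrite /K; ring.
apply: (le_trans detP'); rewrite detE !normrM normrX normr_nat.
have step : b%:R ^+ (m + n) * (K * X ^+ d) <=
    (K * (b%:R * (2 * (b%:R * a)) ^+ d)) ^+ (m + n).+1 * H ^+ d.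
  rewrite /X exprMn -exprM mulnC exprM.
  set u := (2 * (b%:R * a)) ^+ d.
  have u1 : 1 <= u.
    by rewrite exprn_ege1 //; have := ler_pM ler01 ler01 b1 a1; lra.
  rewrite [leLHS](_ : _ = K * (b%:R ^+ (m + n) * u ^+ (m + n)) * H ^+ d); last by ring.
  rewrite ler_wpM2r ?exprn_ge0 // -exprMn [leRHS]exprMn.
  apply: ler_pM => //.
  - exact: le_trans K1.
  - by rewrite exprn_ge0 // mulr_ge0 // (le_trans _ u1).
  - by rewrite exprS ler_peMr ?exprn_ege1 // (le_trans _ K1).
  - by rewrite exprS ler_peMl ?exprn_ege1 ?exprn_ge0 ?mulr_ge0 // ?(le_trans _ u1) // ?mulr_ege1.
rewrite mulrAC mulrC -mulrA ler_wpM2l //.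
apply: le_trans step; rewrite ler_wpM2l ?exprn_ge0 //.
Qed.

(** * The Hermite-Lindemann theorem for real numbers *)

Lemma leq_fact_exp (n k : nat) : (n`! ^ k <= (n * k)`!)%N.
Proof.
elim: k => [|k IH]; first by rewrite muln0.
rewrite expnS mulnS -(bin_fact (leq_addr (n * k) n)) addKn.
by rewrite -[leqLHS]mul1n leq_mul ?bin_gt0 ?leq_addr // leq_mul.
Qed.

(** The term of index [n] in the series of [exp(2 B)] shows that [B^n] over the factorial of [n] is
    below [exp(2 B) / 2^n], and [2^n] outgrows [K exp(2 B)]. *)
Lemma ex_exp_lt_fact (R : realType) (K B : R) : 0 < B ->
  exists n : nat, K * B ^+ n < n`!%:R.
Proof.
move=> B0.
pose n := (Num.bound `|K * expR (2 * B)|).+1.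
exists n.
have n1 : (2 * B) ^+ n / n`!%:R < expR (2 * B).
  apply: lt_le_trans (expR_ge1Dxn n.-1 _); last by rewrite mulr_ge0 // ltW.
  by rewrite ltrDr.
have n2 : K * expR (2 * B) < 2 ^+ n.
  apply: le_lt_trans (ler_norm _) _; apply: lt_le_trans (natrS_le_exp2 R n).
  apply: lt_trans (archi_boundP (normr_ge0 _)) _.
  by rewrite ltr_nat ltnS.
have e0 := expR_gt0 (2 * B).
have f0 : 0 < n`!%:R :> R by rewrite ltr0n fact_gt0.
have Bn0 : 0 < B ^+ n by rewrite exprn_gt0.
rewrite ltr_pdivrMr // exprMn in n1.
rewrite -(ltr_pM2r e0) mulrAC; apply: le_lt_trans (_ : 2 ^+ n * B ^+ n < _).
  by rewrite ler_wpM2r ?ltW.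
by rewrite [ltRHS]mulrC.
Qed.

(** Everything is decided by counting factorials of [n]. The integral form is [n! L^N E(x)], of
    height at most [n! G^N], so the Liouville inequality puts [n!] to the power [d + 1 = M] in the
    numerator. The bound on [E(x)] puts [N!] in the denominator, which is at least [n!] to the power
    [M + 1]. One [n!] is left to beat the geometric term [K B^n]. *)
Lemma hermite_lindemann_pos (R : realType) (x : R) :
  algebraicOver (ratr : rat -> R) x -> 0 < x ->
  ~ algebraicOver (ratr : rat -> R) (expR x).
Proof.
move=> xalg x0 yalg; have [d [C [C1 HC]]] := liouville xalg yalg.
pose M := d.+1; pose L : rat := M`!%:R.
have L0 : 0 < L by rewrite ltr0n fact_gt0.
have C0 : 0 < C by exact: lt_le_trans C1.
pose G : rat := L * (2 * M.+1%:R).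
have G0 : 0 < G by rewrite !mulr_gt0.
pose K : R := expR (M%:R * x) * C ^+ M.+1.
pose B : R := (ratr L * x * ratr G ^+ d) ^+ M.+1 * C.
have rL0 : 0 < ratr L :> R by rewrite ltr0q.
have rG0 : 0 < ratr G :> R by rewrite ltr0q.
have B0 : 0 < B by exact: mulr_gt0 (exprn_gt0 _ (mulr_gt0 (mulr_gt0 rL0 x0) (exprn_gt0 _ rG0))) C0.
have [n] := ex_exp_lt_fact K B0; apply/negP; rewrite -leNgt.
(* Each exponent from 0 to [M] occurs [n] times, so [N = n (M + 1)] operators are inverted. *)
pose s := flatten (nseq n (iota 0 M.+1)); pose N := (n * M.+1)%N.
have sM : all (fun k => k <= M)%N s.
  apply/allP => k /flattenP[t /nseqP[-> _]].
  by rewrite mem_iota add0n ltnS.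
have ssz : size s = N.
  by rewrite size_flatten /shape map_nseq size_iota sumn_nseq mulnC.
pose c := expform M s.
(* The polynomial of exponent 0 has one coefficient more than the others, inherited from the initial
   constant 1; hence degree at most [n] for all. *)
have csz j : (j <= M)%N -> (size (c j) <= n.+1)%N.
  move=> jM; rewrite size_expform count_flatten map_nseq sumn_nseq.
  rewrite count_uniq_mem ?iota_uniq // mem_iota add0n ltnS jM mul1n.
  by case: (j == 0%N).
(* The quotient of factorials passes from divided powers to ordinary coefficients, and [L^N] clears
   the remaining denominators. *)
pose a j i : rat := n`!%:R / i`!%:R * (L ^+ N * (c j)`_i).
have aint j i : (i <= n)%N -> (j <= M)%N -> a j i \is a Num.int.
  move=> ni jM; apply: rpredM.
    have /dvdnP[q ->] : (i`! %| n`!)%N by rewrite -(bin_fact ni) dvdn_mull // dvdn_mulr.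
    by rewrite natrM mulfK ?rpred_nat // pnatr_eq0 -lt0n fact_gt0.
  have := expform_int i sM jM; rewrite ssz -/c -/L => h.
  have := rpredM h (rpredX i (rpred_nat _ M`!)).
  by rewrite -/L divfK // expf_neq0 ?gt_eqF.
have ale j i : (j <= M)%N -> `|a j i| <= n`!%:R * G ^+ N.
  move=> jM; rewrite /a normrM normrM normfV !normr_nat.
  have f1 : 1 <= i`!%:R :> rat by rewrite ler1n fact_gt0.
  apply: ler_pM; rewrite ?mulr_ge0 ?invr_ge0 //.
    by rewrite ler_pdivrMr ?(lt_le_trans ltr01) // ler_peMr.
  rewrite normrM normrX gtr0_norm // /G exprMn ler_wpM2l ?exprn_ge0 ?(ltW L0) //.
  have := expform_bound i sM jM; rewrite ssz -/c => h; apply: le_trans h.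
  by rewrite ler_peMr // exprn_ege1.
pose p (i : 'I_n.+1) (j : 'I_M.+1) : int := Num.floor (a j i).
have pE i j : (p i j)%:~R = ratr (a j i) :> R.
  rewrite /p -[X in _ = ratr X]floorK ?ratr_int //.
  by apply: aint; rewrite -ltnS.
have [Epos Ele] := andP (expeval_expform sM x0).
rewrite -/c in Epos Ele; rewrite ssz in Ele.
have zE : \sum_i \sum_j (p i j)%:~R * x ^+ i * expR x ^+ j =
    n`!%:R * ratr L ^+ N * expeval M c x.
  rewrite exchange_big /= /expeval mulr_sumr; apply: eq_bigr => j _.
  rewrite expRM_natl [RHS]mulrA.
  rewrite (@horner_coef_wide _ n.+1); last first.
    by rewrite (leq_trans (size_poly _ _)) // csz // -ltnS.
  rewrite mulr_sumr mulr_suml; apply: eq_bigr => i _.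
  rewrite pE coef_dpoly /a !rmorphM /= fmorphV /=.
  rewrite (ratr_nat R n`!) (ratr_nat R i`!) rmorphXn /=.
  by ring.
have := HC _ _ p (n`!%:R * ratr G ^+ N).
rewrite /= zE => {}HC.
have fpos k : 0 < k`!%:R :> R by rewrite ltr0n fact_gt0.
have LN0 : 0 < ratr L ^+ N :> R by rewrite exprn_gt0.
have {HC} : 1 <= `|n`!%:R * ratr L ^+ N * expeval M c x| * C ^+ (n + M).+1 *
   (n`!%:R * ratr G ^+ N) ^+ d.
  apply: HC => [i j|]; last by rewrite gt_eqF // !mulr_gt0.
  have := ale j i; rewrite -ltnS ltn_ord => /(_ isT) => aji.
  rewrite pE -ratr_norm -(ratr_nat R) -rmorphXn -rmorphM /=.
  by rewrite ler_rat.
rewrite gtr0_norm ?mulr_gt0 // => H1.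
have NF : (n`!%:R : R) ^+ M.+1 <= N`!%:R by rewrite -natrX ler_nat leq_fact_exp.
rewrite -(ler_pM2r (exprn_gt0 M (fpos n))) -exprS; apply: le_trans NF _.
have H2 : N`!%:R <= N`!%:R * (n`!%:R * ratr L ^+ N *
    (expR (M%:R * x) * x ^+ N / N`!%:R) * C ^+ (n + M).+1 *
    (n`!%:R * ratr G ^+ N) ^+ d).
  rewrite ler_peMr ?(ltW (fpos _)) //; apply: le_trans H1 _.
  rewrite ler_wpM2r ?exprn_ge0 ?mulr_ge0 ?exprn_ge0 ?ler0q ?(ltW G0) //.
  rewrite ler_wpM2r ?exprn_ge0 ?(ltW C0) // ler_wpM2l // ltW // mulr_gt0 //.
apply: le_trans H2 _; rewrite le_eqVlt; apply/orP; left; apply/eqP.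
have BE (u g : R) : ((u * x * g ^+ d) ^+ M.+1 * C) ^+ n =
    u ^+ N * x ^+ N * (g ^+ N) ^+ d * C ^+ n.
  by rewrite exprMn -[_ ^+ M.+1 ^+ n]exprM mulnC -/N !exprMn -!exprM (mulnC d).
rewrite /B BE /K -addnS exprD [(n`!%:R * _) ^+ d]exprMn [n`!%:R ^+ M]exprS.
by field; rewrite gt_eqF.
Qed.

Lemma hermite_lindemann (R : realType) (x : R) :
  algebraicOver (ratr : rat -> R) x -> x != 0 ->
  ~ algebraicOver (ratr : rat -> R) (expR x).
Proof.
move=> xalg; rewrite neq_lt => /orP[x0|]; last exact: hermite_lindemann_pos.
have : ~ algebraicOver (ratr : rat -> R) (expR (- x)).
  by apply: hermite_lindemann_pos; [exact: algebraic_opp|rewrite oppr_gt0].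
by move=> H /algebraic_inv; rewrite -expRN.
Qed.

(** * Derivatives of determinants and inverses *)

Section MatrixPencil.
Variables (R : realType) (n : nat).
Implicit Types S E : 'M[R]_n.

(** Over the polynomial ring, the determinant and adjugate of [S + t E] become polynomials in [t],
    hence continuous. *)
Definition pencil S E : 'M[{poly R}]_n := map_mx polyC S + 'X *: map_mx polyC E.

Lemma horner_pencil S E t : map_mx (horner_eval t) (pencil S E) = S + t *: E.
Proof.
by apply/matrixP => i j; rewrite !mxE /horner_eval hornerD hornerM hornerX !hornerC.
Qed.

Lemma det_pencil S E t : \det (S + t *: E) = (\det (pencil S E)).[t].
Proof. by rewrite -horner_pencil det_map_mx. Qed.

Lemma adj_pencil S E t i j : (\adj (S + t *: E)) i j = ((\adj (pencil S E)) i j).[t].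
Proof. by rewrite -horner_pencil -map_mx_adj mxE. Qed.

Lemma posdefmx_det_neq0 S : posdefmx S -> \det S != 0.
Proof.
move=> [_ Spos]; apply/negP => /det0P[v v0 vS].
have /Spos : v^T != 0 by rewrite -(inj_eq (@trmx_inj _ _ _)) trmxK trmx0.
by rewrite trmxK vS mul0mx mxE ltxx.
Qed.

Lemma posdefmx_unit S : posdefmx S -> S \in unitmx.
Proof. by move=> /posdefmx_det_neq0; rewrite unitmxE unitfE. Qed.

Lemma posdefmx1 : posdefmx (1%:M : 'M[R]_n).
Proof.
split; first by rewrite trmx1.
move=> v v0; rewrite mulmx1 mxE.
under eq_bigr do rewrite mxE -expr2.
rewrite lt_neqAle sumr_ge0 ?andbT; last by move=> i _; rewrite sqr_ge0.
apply: contra_neqN v0 => /eqP/esym/psumr_eq0P H; apply/colP => i.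
by apply/eqP; rewrite mxE -sqrf_eq0 H // => j _; rewrite sqr_ge0.
Qed.

Lemma posdefmx_segment S T (t : R) : posdefmx S -> posdefmx T -> 0 <= t <= 1 ->
  posdefmx (S + t *: (T - S)).
Proof.
move=> [St Sp] [Tt Tp] /andP[t0 t1]; split.
  by rewrite linearD linearZ linearB /= St Tt.
move=> v v0; rewrite mulmxDr mulmxDl -scalemxAr -scalemxAl mulmxBr mulmxBl.
have := Sp _ v0; have := Tp _ v0; rewrite !mxE.
set a := \sum_i _; set b := \sum_i _ => a0 b0.
have -> : b + t * (a - b) = (1 - t) * b + t * a by ring.
have [t1'|t1'] := ltP t 1; last first.
  by rewrite (_ : t = 1) ?subrr ?mul0r ?add0r ?mul1r //; apply/le_anti/andP.
by rewrite ltr_wpDr ?mulr_ge0 ?(ltW a0) // mulr_gt0 // subr_gt0.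
Qed.

(** The segment from the identity to [S] stays positive definite, so the determinant, a polynomial
    along it with value 1 at the start, never vanishes. *)
Lemma posdefmx_det_gt0 S : posdefmx S -> 0 < \det S.
Proof.
move=> Sp; rewrite ltNge; apply/negP => S0.
have Pt t : (- \det (pencil 1%:M (S - 1%:M))).[t] = - \det (1%:M + t *: (S - 1%:M)).
  by rewrite hornerN det_pencil.
have [||t t01 /rootP] := @poly_ivt R (- \det (pencil 1%:M (S - 1%:M))) 0 1.
- exact: ler01.
- by rewrite !Pt scale0r addr0 scale1r addrC subrK det1 oppr_ge0 S0 lerN10.
rewrite Pt => /eqP; rewrite oppr_eq0; apply/negP.
exact/posdefmx_det_neq0/posdefmx_segment/t01/Sp/posdefmx1.
Qed.

End MatrixPencil.

(** As a polynomial in [t], [det(1 + t B)] is the reversed characteristic polynomial of [- B], so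
    its linear coefficient is the trace of [B]. *)
Lemma is_derive_det1 (R : realType) n (B : 'M[R]_n.+1) :
  is_derive (0 : R) (1 : R) (fun t : R => \det (1%:M + t *: B)) (\tr B).
Proof.
pose p := char_poly (- B).
pose q : {poly R} := \poly_(k < n.+2) p`_(n.+1 - k).
have pn : p`_n.+1 = 1.
  by have := char_poly_monic (- B); rewrite monicE lead_coefE size_char_poly => /eqP.
have -> : (fun t : R => \det (1%:M + t *: B)) = horner q.
  apply/funext => t; have [->|t0] := eqVneq t 0.
    by rewrite scale0r addr0 det1 horner_coef0 coef_poly subn0 pn.
  have -> : 1%:M + t *: B = t *: (t^-1%:M - (- B)).
    by rewrite opprK scalerDr scale_scalar_mx divff.
  rewrite detZ.
  have -> : \det (t^-1%:M - - B) = p.[t^-1].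
    rewrite /p /char_poly -[RHS]/(horner_eval t^-1 _) -det_map_mx; congr (\det _).
    apply/matrixP => i j; rewrite !mxE /= /horner_eval hornerD hornerN hornerC.
    by case: (i == j); rewrite ?mulr1n ?mulr0n ?hornerX ?horner0.
  rewrite (@horner_coef_wide _ n.+2 p) ?size_char_poly //.
  rewrite horner_poly mulr_sumr [LHS](reindex_inj rev_ord_inj) /=.
  apply: eq_bigr => k _; rewrite subSS mulrCA; congr (_ * _).
  have kn : (k <= n.+1)%N by rewrite -ltnS.
  rewrite exprVn -[X in t ^+ X / _](subnKC kn) exprD mulfK //.
  by rewrite expf_neq0.
apply: (is_derive_eq (is_derive_poly q 0)).
rewrite horner_coef0 coef_deriv coef_poly /= mulr1n subn1 /= /p.
by have := char_poly_trace (- B) isT; rewrite /= => ->; rewrite linearN opprK.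
Qed.

Lemma is_derive_det (R : realType) n (S E : 'M[R]_n.+1) : S \in unitmx ->
  is_derive (0 : R) (1 : R) (fun t : R => \det (S + t *: E))
    (\det S * \tr (invmx S *m E)).
Proof.
move=> Su.
have -> : (fun t : R => \det (S + t *: E)) =
    (fun t => \det S * \det (1%:M + t *: (invmx S *m E))).
  apply/funext => t; rewrite -det_mulmx mulmxDr mulmx1 -scalemxAr mulmxA.
  by rewrite mulmxV // mul1mx.
exact: is_derive1Ml (is_derive_det1 _).
Qed.

Lemma near_det_neq0 (R : realType) n (S E : 'M[R]_n) : \det S != 0 ->
  \forall t \near (0 : R), \det (S + t *: E) != 0.
Proof.
move=> S0; have /cvgr_neq0 := @continuous_horner R (\det (pencil S E)) 0.
rewrite -det_pencil scale0r addr0 => /(_ S0).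
by apply: filterS => t; rewrite det_pencil.
Qed.

Lemma invmx_det_adj (R : realType) n (S : 'M[R]_n) : \det S != 0 ->
  invmx S = (\det S)^-1 *: \adj S.
Proof. by rewrite -unitfE -unitmxE /invmx => ->. Qed.

(** The resolvent identity [(S + t E)^-1 = S^-1 - t S^-1 E (S + t E)^-1], valid near 0, exhibits the
    difference quotient; only its continuity at 0 remains, and there it is the rational function [h]
    up to sign. *)
Lemma is_derive_invmx (R : realType) n (S E : 'M[R]_n) (u v : 'cV[R]_n) :
  S \in unitmx ->
  is_derive (0 : R) (1 : R)
    (fun t : R => (u^T *m invmx (S + t *: E) *m v) 0 0)
    (- (u^T *m invmx S *m E *m invmx S *m v) 0 0).
Proof.
move=> Su.
have S0 : \det S != 0 by rewrite -unitfE -unitmxE.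
pose w : 'rV[R]_n := u^T *m invmx S *m E.
pose p : {poly R} := \sum_i \sum_j (w 0 j)%:P * (\adj (pencil S E)) j i * (v i 0)%:P.
have pE t : (w *m \adj (S + t *: E) *m v) 0 0 = p.[t].
  rewrite mxE horner_sum; apply: eq_bigr => i _; rewrite mxE mulr_suml horner_sum.
  by apply: eq_bigr => j _; rewrite !hornerM !hornerC adj_pencil.
pose h t : R := (\det (pencil S E)).[t]^-1 * p.[t].
have hE t : \det (S + t *: E) != 0 ->
    (w *m invmx (S + t *: E) *m v) 0 0 = h t.
  move=> St; rewrite invmx_det_adj // -scalemxAr -scalemxAl mxE pE.
  by rewrite /h det_pencil.
apply: (@near_eq_is_derive R R R
  (fun t => (u^T *m invmx S *m v) 0 0 - t * h t)).
  apply: filterS (near_det_neq0 E S0) => t St; rewrite -hE // /w.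
  have Stu : S + t *: E \in unitmx by rewrite unitmxE unitfE.
  have {2}-> : invmx (S + t *: E) = invmx S - t *: (invmx S *m E *m invmx (S + t *: E)).
    apply/eqP; rewrite eq_sym subr_eq; apply/eqP.
    rewrite -{1}[invmx S]mulmx1 -(mulmxV Stu) mulmxA mulmxDr mulVmx //.
    by rewrite mulmxDl mul1mx -scalemxAr -scalemxAl.
  rewrite mulmxBr mulmxBl -scalemxAr -scalemxAl !mulmxA.
  by move: (_ *m v) (_ *m v) => X Y; rewrite !mxE.
apply/is_derive1_caratheodory; exists (fun t => - h t); split.
- by move=> t; rewrite mul0r; ring.
- apply: cvgN; apply: cvgM; last exact: continuous_horner.
  apply: cvgV; last exact: continuous_horner.
  by rewrite -det_pencil scale0r addr0.
- by rewrite -hE ?scale0r ?addr0.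
Qed.

(** * Critical equations *)

Lemma trmx_invmx_sym (R : comUnitRingType) n (S : 'M[R]_n) :
  S^T = S -> (invmx S)^T = invmx S.
Proof. by move=> St; rewrite trmx_inv St. Qed.

Lemma gaussian_gt0 (R : realType) n (m x : 'cV[R]_n) S :
  posdefmx S -> 0 < gaussian m S x.
Proof.
move=> /posdefmx_det_gt0 S0; apply: mulr_gt0 (expR_gt0 _).
by apply: mulr_gt0; rewrite powR_gt0 ?mulr_gt0 ?pi_gt0.
Qed.

Lemma gmm_density_gt0 (R : realType) n (p : gmm_param R n) x :
  gmm_valid p -> 0 < gmm_density p x.
Proof.
move=> [/andP[a0 a1] S1 S2]; rewrite /gmm_density.
have g1 := gaussian_gt0 (mean1 p) x S1; have g2 := gaussian_gt0 (mean2 p) x S2.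
have [a1'|a1'] := ltP (weight p) 1.
  apply: ltr_wpDl; first by rewrite mulr_ge0 ?(ltW g1).
  by rewrite mulr_gt0 ?subr_gt0.
apply: ltr_wpDr; first by rewrite mulr_ge0 ?subr_ge0 ?(ltW g2).
by rewrite mulr_gt0 // (lt_le_trans _ a1').
Qed.

Lemma is_derive_gaussian_cov (R : realType) n (m x : 'cV[R]_n.+1)
    (S E : 'M[R]_n.+1) : posdefmx S ->
  is_derive (0 : R) (1 : R) (fun t : R => gaussian m (S + t *: E) x)
    (gaussian m S x * (1 / 2 *
      (((x - m)^T *m invmx S *m E *m invmx S *m (x - m)) 0 0 -
       \tr (invmx S *m E)))).
Proof.
move=> Sp; have Su := posdefmx_unit Sp; have S0 := posdefmx_det_gt0 Sp.
have dd := is_derive_det E Su.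
have qd := is_derive_invmx E (x - m) (x - m) Su.
have ed := is_derive1_expR (is_derive1Ml (- (1 / 2)) qd).
have pd : is_derive (0 : R) (1 : R)
    (fun t : R => (\det (S + t *: E)) `^ (- (1 / 2)))
    ((- (1 / 2)) * (\det S) `^ (- (1 / 2)) * \tr (invmx S *m E)).
  have S0' : 0 < \det (S + (0 : R) *: E) by rewrite scale0r addr0.
  have := is_derive1_comp (is_derive1_powR (- (1 / 2)) S0') dd.
  move=> h; apply: (is_derive_eq h); rewrite scale0r addr0.
  rewrite powRB ?(gt_eqF S0) ?implybT // powRr1 ?(ltW S0) //.
  by field; rewrite gt_eqF.
have h := is_derive1M (is_derive1Ml ((2 * pi) `^ (- (n.+1%:R / 2))) pd) ed.
apply: (is_derive_eq h).
by rewrite /gaussian scale0r addr0; ring.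
Qed.

Lemma is_derive_gaussian_mean (R : realType) n (m x d : 'cV[R]_n)
    (S : 'M[R]_n) : posdefmx S ->
  is_derive (0 : R) (1 : R) (fun t : R => gaussian (m + t *: d) S x)
    (gaussian m S x * (d^T *m invmx S *m (x - m)) 0 0).
Proof.
move=> Sp; pose q (u v : 'cV[R]_n) : R := (u^T *m invmx S *m v) 0 0.
have qC u v : q u v = q v u.
  rewrite /q -[in RHS](trmxK (v^T *m _ *m u)) [in RHS]mxE !trmx_mul trmxK.
  by rewrite trmx_invmx_sym ?mulmxA //; case: Sp.
have qB t (u v : 'cV[R]_n) : q (u - t *: d) v = q u v - t * q d v.
  rewrite /q [_^T]linearB /= [(_ *: d)^T]linearZ /= !mulmxBl -!scalemxAl.
  by move: (_ *m v) (_ *m v) => A B; rewrite !mxE.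
have qE t : q (x - (m + t *: d)) (x - (m + t *: d)) =
    q (x - m) (x - m) - t * (2 * q d (x - m)) + t ^+ 2 * q d d.
  rewrite opprD addrA; move: (x - m) => y.
  by rewrite qB (qC _ (_ - _)) qB (qC d (_ - _)) qB (qC _ d); ring.
have qd : is_derive (0 : R) (1 : R)
    (fun t => q (x - (m + t *: d)) (x - (m + t *: d))) (- (2 * q d (x - m))).
  under eq_fun do rewrite qE.
  have cd (c : R) : is_derive (0 : R) (1 : R) (fun=> c) 0 by exact: is_derive_cst.
  have h := is_deriveD (is_deriveB (cd (q (x - m) (x - m)))
    (is_derive1M (is_derive1_id 0) (cd (2 * q d (x - m)))))
    (is_derive1M (is_derive1X 2 (is_derive1_id 0)) (cd (q d d))).
  by apply: (is_derive_eq h); ring.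
have ed := is_derive1_expR (is_derive1Ml (- (1 / 2)) qd).
apply: (is_derive_eq (is_derive1Ml _ ed)).
by rewrite /gaussian -/(q _ _) scale0r addr0 /q; field.
Qed.

Lemma is_derive_loglik (R : realType) n N (x : 'I_N -> 'cV[R]_n)
    (path : R -> gmm_param R n) (p : gmm_param R n) (d : 'I_N -> R) :
  path 0 = p -> (forall i, 0 < gmm_density p (x i)) ->
  (forall i, is_derive (0 : R) (1 : R)
     (fun t => gmm_density (path t) (x i)) (d i)) ->
  is_derive (0 : R) (1 : R) (fun t => loglik x (path t))
    (\sum_i d i / gmm_density p (x i)).
Proof.
move=> <- f0 fd; apply: is_derive1_sum => i.
have h := @is_derive1_comp R (@ln R) (fun t => gmm_density (path t) (x i)) 0 _ _
  (is_derive1_ln (f0 i)) (fd i).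
by apply: (is_derive_eq h); rewrite mulrC.
Qed.

Lemma is_derive_0P (R : realType) (f : R -> R) (x df : R) :
  is_derive x (1 : R) f df -> is_derive x (1 : R) f 0 <-> df = 0.
Proof.
move=> fd; split => [fd0|<- //].
by have := @derive_val _ _ _ _ _ _ _ fd; rewrite (@derive_val _ _ _ _ _ _ _ fd0).
Qed.

Lemma sum_score_mean (R : realType) n N (r : 'I_N -> R) (x : 'I_N -> 'cV[R]_n)
    m (S : 'M[R]_n) : S \in unitmx ->
  (forall i, \sum_k r k * ((delta_mx i 0 : 'cV[R]_n)^T *m invmx S *m (x k - m)) 0 0 = 0) <->
  \sum_k r k *: (x k - m) = 0.
Proof.
move=> Su; have E i : \sum_k r k * ((delta_mx i 0 : 'cV[R]_n)^T *m invmx S *m (x k - m)) 0 0 =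
    (invmx S *m \sum_k r k *: (x k - m)) i 0.
  rewrite mulmx_sumr summxE; apply: eq_bigr => k _.
  by rewrite -scalemxAr [RHS]mxE trmx_delta -mulmxA -rowE mxE.
split=> [H|H i]; last by rewrite E H mulmx0 mxE.
have W0 : invmx S *m (\sum_k r k *: (x k - m)) = 0.
  by apply/colP => i; rewrite -E H mxE.
by rewrite -[LHS](mulKVmx Su) W0 mulmx0.
Qed.

(** An off-diagonal direction sees its entry twice, a diagonal one once. The multiplicity is never
    zero, so these directions detect every entry of a symmetric matrix. *)
Lemma mxtrace_sym_dir (R : realType) n (W : 'M[R]_n) i j : W^T = W ->
  \tr (W *m sym_dir R i j) = W i j *+ (1 + (i != j)).
Proof.
move=> Wt.
have -> : sym_dir R i j = delta_mx i j + (i != j)%:R *: delta_mx j i.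
  apply/matrixP => k l; rewrite !mxE.
  case: (eqVneq i j) => [<-|ij] /=; first by rewrite orbb mul0r addr0.
  rewrite mul1r; case: (eqVneq k i) => [->|ki] /=.
    by rewrite (negPf ij) /= orbF addr0.
  by rewrite add0r.
have td k l : \tr (W *m delta_mx k l) = W l k.
  rewrite /mxtrace (bigD1 l) //= big1 ?addr0; last first.
    move=> a al; rewrite mxE big1 // => b _; rewrite mxE.
    by rewrite (negPf al) andbF mulr0.
  rewrite mxE (bigD1 k) //= big1 ?addr0; first by rewrite mxE !eqxx mulr1.
  by move=> b bk; rewrite mxE (negPf bk) mulr0.
rewrite mulmxDr linearD /= td -scalemxAr linearZ /= td.
have -> : W j i = W i j by rewrite -{1}Wt mxE.
by case: (i != j); rewrite ?mul1r ?mul0r ?addr0.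
Qed.

(** The score in direction [D] is half the trace of [W D] with [W = S^-1 M S^-1] symmetric, so its
    vanishing in all symmetric directions forces [W = 0], hence [M = 0]. *)
Lemma sum_score_cov (R : realType) n N (r : 'I_N -> R) (x : 'I_N -> 'cV[R]_n)
    m (S : 'M[R]_n) : posdefmx S ->
  (forall i j, \sum_k r k * (1 / 2 *
      (((x k - m)^T *m invmx S *m sym_dir R i j *m invmx S *m (x k - m)) 0 0 -
       \tr (invmx S *m sym_dir R i j))) = 0) <->
  \sum_k r k *: ((x k - m) *m (x k - m)^T - S) = 0.
Proof.
move=> Sp; have Su := posdefmx_unit Sp; have [St _] := Sp.
set M := (X in _ <-> X = 0); pose W := invmx S *m M *m invmx S.
have E D : \sum_k r k * (1 / 2 *
      (((x k - m)^T *m invmx S *m D *m invmx S *m (x k - m)) 0 0 -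
       \tr (invmx S *m D))) = 1 / 2 * \tr (W *m D).
  rewrite /W /M mulmx_sumr !mulmx_suml [\tr _ in RHS]raddf_sum mulr_sumr /=.
  apply: eq_bigr => k _; move: (x k - m) => y.
  rewrite -scalemxAr -!scalemxAl linearZ /= mulrCA; congr (_ * (_ * _)).
  rewrite mulmxBr mulVmx // !mulmxBl mul1mx linearB /=; congr (_ - _).
  by rewrite -trace_mx11 mxtrace_mulC -!mulmxA [RHS]mxtrace_mulC !mulmxA.
have Wt : W^T = W.
  rewrite !trmx_mul trmx_invmx_sym // mulmxA; congr (_ *m _ *m _).
  rewrite /M linear_sum /=; apply: eq_bigr => k _.
  by rewrite linearZ linearB /= trmx_mul trmxK St.
split=> [H|H i j]; last by rewrite E /W H mulmx0 mul0mx mul0mx mxtrace0 mulr0.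
have W0 : W = 0.
  apply/matrixP => i j; rewrite [RHS]mxE; have := H i j.
  rewrite E mxtrace_sym_dir //.
  by move=> /eqP; rewrite div1r mulf_eq0 invr_eq0 pnatr_eq0 mulrn_eq0 => /eqP.
rewrite -[M](mulKVmx Su) -[_ *m M](mulmxKV Su).
by rewrite -/W W0 mul0mx mulmx0.
Qed.

(** The responsibility of the first component for [x] in the EM algorithm. *)
Definition posterior (R : realType) n (p : gmm_param R n) (x : 'cV[R]_n) : R :=
  weight p * gaussian (mean1 p) (cov1 p) x / gmm_density p x.

Lemma onem_posterior (R : realType) n (p : gmm_param R n) (x : 'cV[R]_n) :
  gmm_valid p -> 1 - posterior p x =
    (1 - weight p) * gaussian (mean2 p) (cov2 p) x / gmm_density p x.
Proof.
move=> pv; have f0 := gmm_density_gt0 x pv.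
rewrite /posterior -[in LHS](divff (lt0r_neq0 f0)) -mulrBl; congr (_ / _).
by rewrite [in LHS]/gmm_density addrC addKr.
Qed.

(** These are the fixed-point equations of EM: differentiating [ln] of the density turns every score
    into a sum weighted by the posteriors. *)
Lemma critical_pointP (R : realType) n N (x : 'I_N -> 'cV[R]_n.+1)
    (p : gmm_param R n.+1) (r := fun k => posterior p (x k)) :
  gmm_valid p -> 0 < weight p < 1 ->
  critical_point x p <->
  [/\ \sum_k r k = N%:R * weight p,
      \sum_k r k *: (x k - mean1 p) = 0,
      \sum_k (1 - r k) *: (x k - mean2 p) = 0,
      \sum_k r k *: ((x k - mean1 p) *m (x k - mean1 p)^T - cov1 p) = 0 &
      \sum_k (1 - r k) *: ((x k - mean2 p) *m (x k - mean2 p)^T - cov2 p) = 0].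
Proof.
move=> pv a01; have f0 k := gmm_density_gt0 (x k) pv.
have r1 k : 1 - r k = (1 - weight p) * gaussian (mean2 p) (cov2 p) (x k) /
    gmm_density p (x k) by exact: onem_posterior.
have a0 : weight p != 0 by case/andP: a01 => /lt0r_neq0.
have a1 : 1 - weight p != 0.
  by rewrite subr_eq0 eq_sym; case/andP: a01 => _ /lt_eqF ->.
have [_ S1p S2p] := pv.
have M1 := sum_score_mean r x (mean1 p) (posdefmx_unit S1p).
have M2 := sum_score_mean (fun k => 1 - r k) x (mean2 p) (posdefmx_unit S2p).
have M3 := sum_score_cov r x (mean1 p) S1p.
have M4 := sum_score_cov (fun k => 1 - r k) x (mean2 p) S2p.
have M0 : \sum_k r k = N%:R * weight p <->
    \sum_k (gaussian (mean1 p) (cov1 p) (x k) - gaussian (mean2 p) (cov2 p) (x k)) /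
      gmm_density p (x k) = 0.
  (* Multiplied by [weight p * (1 - weight p)], the score of the weight at [x k] becomes
     [r k - weight p]. *)
  have E : (\sum_k (gaussian (mean1 p) (cov1 p) (x k) -
      gaussian (mean2 p) (cov2 p) (x k)) / gmm_density p (x k)) *
      (weight p * (1 - weight p)) = \sum_k r k - N%:R * weight p.
    have -> : N%:R * weight p = \sum_(k < N) weight p.
      by rewrite sumr_const card_ord mulr_natl.
    rewrite -sumrB mulr_suml; apply: eq_bigr => k _.
    have -> : (gaussian (mean1 p) (cov1 p) (x k) - gaussian (mean2 p) (cov2 p) (x k))
        / gmm_density p (x k) = r k / weight p - (1 - r k) / (1 - weight p).
      rewrite r1 /r /posterior; field.
      by rewrite a1 a0 lt0r_neq0.
    by field; rewrite a1.
  split=> [H|H]; last by apply/eqP; rewrite -subr_eq0 -E H mul0r.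
  move: E; rewrite H subrr => /eqP.
  by rewrite mulf_eq0 mulf_eq0 (negPf a0) (negPf a1) !orbF => /eqP.
have rE k : r k =
  weight p * gaussian (mean1 p) (cov1 p) (x k) / gmm_density p (x k) by [].
move: r r1 rE f0 M0 M1 M2 M3 M4 {a01 a0 a1} => r r1 rE f0 M0 M1 M2 M3 M4.
case: p pv r1 rE f0 S1p S2p M0 M1 M2 M3 M4
  => a m1 m2 S1 S2 pv /= r1 rE f0 S1p S2p M0 M1 M2 M3 M4.
have i0 (c : R) : is_derive (0 : R) (1 : R) (fun=> c) 0 by exact: is_derive_cst.
have D0 : is_derive (0 : R) (1 : R) (fun t => loglik x (GmmParam (a + t) m1 m2 S1 S2))
    (\sum_k (gaussian m1 S1 (x k) - gaussian m2 S2 (x k)) /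
      gmm_density (GmmParam a m1 m2 S1 S2) (x k)).
  apply: is_derive_loglik f0 _ => [|k]; first by rewrite addr0.
  have h1 := is_deriveD (i0 a) (is_derive1_id 0).
  have h2 := is_deriveB (i0 1) h1.
  have h := is_deriveD (is_derive1M h1 (i0 (gaussian m1 S1 (x k))))
    (is_derive1M h2 (i0 (gaussian m2 S2 (x k)))).
  by apply: (is_derive_eq h) => /=; ring.
have D1 i : is_derive (0 : R) (1 : R)
    (fun t => loglik x (GmmParam a (m1 + t *: delta_mx i 0) m2 S1 S2))
    (\sum_k r k * ((delta_mx i 0 : 'cV[R]_n.+1)^T *m invmx S1 *m (x k - m1)) 0 0).
  under eq_bigr do rewrite rE mulrAC.
  apply: is_derive_loglik f0 _ => [|k]; first by rewrite scale0r addr0.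
  have h := is_deriveD (is_derive1Ml a
    (is_derive_gaussian_mean m1 (x k) (delta_mx i 0) S1p))
    (i0 ((1 - a) * gaussian m2 S2 (x k))).
  by apply: (is_derive_eq h); rewrite addr0 mulrA.
have D2 i : is_derive (0 : R) (1 : R)
    (fun t => loglik x (GmmParam a m1 (m2 + t *: delta_mx i 0) S1 S2))
    (\sum_k (1 - r k) * ((delta_mx i 0 : 'cV[R]_n.+1)^T *m invmx S2 *m (x k - m2)) 0 0).
  under eq_bigr do rewrite r1 mulrAC.
  apply: is_derive_loglik f0 _ => [|k]; first by rewrite scale0r addr0.
  have h := is_deriveD (i0 (a * gaussian m1 S1 (x k))) (is_derive1Ml (1 - a)
    (is_derive_gaussian_mean m2 (x k) (delta_mx i 0) S2p)).
  by apply: (is_derive_eq h); rewrite add0r mulrA.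
have D3 i j : is_derive (0 : R) (1 : R)
    (fun t => loglik x (GmmParam a m1 m2 (S1 + t *: sym_dir R i j) S2))
    (\sum_k r k * (1 / 2 *
      (((x k - m1)^T *m invmx S1 *m sym_dir R i j *m invmx S1 *m (x k - m1)) 0 0 -
       \tr (invmx S1 *m sym_dir R i j)))).
  under eq_bigr do rewrite rE mulrAC.
  apply: is_derive_loglik f0 _ => [|k]; first by rewrite scale0r addr0.
  have h := is_deriveD (is_derive1Ml a
    (is_derive_gaussian_cov m1 (x k) (sym_dir R i j) S1p))
    (i0 ((1 - a) * gaussian m2 S2 (x k))).
  by apply: (is_derive_eq h); rewrite addr0 mulrA.
have D4 i j : is_derive (0 : R) (1 : R)
    (fun t => loglik x (GmmParam a m1 m2 S1 (S2 + t *: sym_dir R i j)))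
    (\sum_k (1 - r k) * (1 / 2 *
      (((x k - m2)^T *m invmx S2 *m sym_dir R i j *m invmx S2 *m (x k - m2)) 0 0 -
       \tr (invmx S2 *m sym_dir R i j)))).
  under eq_bigr do rewrite r1 mulrAC.
  apply: is_derive_loglik f0 _ => [|k]; first by rewrite scale0r addr0.
  have h := is_deriveD (i0 (a * gaussian m1 S1 (x k))) (is_derive1Ml (1 - a)
    (is_derive_gaussian_cov m2 (x k) (sym_dir R i j) S2p)).
  by apply: (is_derive_eq h); rewrite add0r mulrA.
split=> [[_ [H0 H1 H2 H3 H4]]|[H0 H1 H2 H3 H4]].
  split.
  - exact: M0.2 ((is_derive_0P D0).1 H0).
  - exact: M1.1 (fun i => (is_derive_0P (D1 i)).1 (H1 i)).
  - exact: M2.1 (fun i => (is_derive_0P (D2 i)).1 (H2 i)).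
  - exact: M3.1 (fun i j => (is_derive_0P (D3 i j)).1 (H3 i j)).
  - exact: M4.1 (fun i j => (is_derive_0P (D4 i j)).1 (H4 i j)).
split; first exact: pv.
split=> [|i|i|i j|i j].
- exact: (is_derive_0P D0).2 (M0.1 H0).
- exact: (is_derive_0P (D1 i)).2 (M1.2 H1 i).
- exact: (is_derive_0P (D2 i)).2 (M2.2 H2 i).
- exact: (is_derive_0P (D3 i j)).2 (M3.2 H3 i j).
- exact: (is_derive_0P (D4 i j)).2 (M4.2 H4 i j).
Qed.

(** * Transcendence *)

Section AlgebraicNumbers.
Variable R : realType.
Local Notation alg := (algebraicOver (ratr : rat -> R)).

Lemma algebraic_rat (q : rat) : alg (ratr q).
Proof. exact: algebraic_id. Qed.

Lemma algebraic_nat (k : nat) : alg k%:R.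
Proof. by rewrite -(ratr_nat R k); exact: algebraic_rat. Qed.

Lemma algebraic_sum I (r : seq I) (P : pred I) (F : I -> R) :
  (forall i, P i -> alg (F i)) -> alg (\sum_(i <- r | P i) F i).
Proof.
move=> aF; apply: big_ind => //; [exact: algebraic0|exact: algebraic_add].
Qed.

Lemma algebraic_prod I (r : seq I) (P : pred I) (F : I -> R) :
  (forall i, P i -> alg (F i)) -> alg (\prod_(i <- r | P i) F i).
Proof.
move=> aF; apply: big_ind => //; [exact: algebraic1|exact: algebraic_mul].
Qed.

Lemma algebraic_exp z k : alg z -> alg (z ^+ k).
Proof. by move=> az; rewrite -[k]card_ord -prodr_const; exact: algebraic_prod. Qed.

Lemma algebraic_sign k : alg ((-1) ^+ k).
Proof. by apply/algebraic_exp/algebraic_opp/algebraic1. Qed.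

Lemma algebraic_det n (S : 'M[R]_n) : (forall i j, alg (S i j)) -> alg (\det S).
Proof.
move=> aS; apply: algebraic_sum => s _; apply: algebraic_mul.
  exact: algebraic_sign.
exact: algebraic_prod.
Qed.

Lemma algebraic_invmx n (S : 'M[R]_n) i j :
  (forall i j, alg (S i j)) -> alg (invmx S i j).
Proof.
move=> aS; rewrite /invmx; case: ifP => // _.
rewrite !mxE; apply: algebraic_mul; first exact/algebraic_inv/algebraic_det.
apply: algebraic_mul; first exact: algebraic_sign.
by apply: algebraic_det => k l; rewrite !mxE.
Qed.

Lemma algebraic_mulmx m n p (A : 'M[R]_(m, n)) (B : 'M[R]_(n, p)) :
  (forall i j, alg (A i j)) -> (forall i j, alg (B i j)) ->
  forall i j, alg ((A *m B) i j).
Proof.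
move=> aA aB i j; rewrite mxE; apply: algebraic_sum => k _.
exact: algebraic_mul.
Qed.

End AlgebraicNumbers.

(** Squaring removes the square root of the determinant; in a ratio of two such squares the power of
    [2 pi] cancels, leaving determinants and one exponential. *)
Lemma sqr_gaussian (R : realType) n (m x : 'cV[R]_n) S : posdefmx S ->
  gaussian m S x ^+ 2 = ((2 * pi) `^ (- (n%:R / 2))) ^+ 2 * (\det S)^-1 *
    expR (- ((x - m)^T *m invmx S *m (x - m)) 0 0).
Proof.
move=> /posdefmx_det_gt0 S0; rewrite /gaussian 2!exprMn; congr (_ * _ * _).
  rewrite -powR_mulrn ?powR_ge0 // -powRrM.
  by rewrite (_ : - (1 / 2) * 2%:R = -1) ?powR_inv1 ?(ltW S0) //; field.
by rewrite -expRM_natl; congr expR; field.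
Qed.

Lemma nontrivial_weight (R : realType) n (p : gmm_param R n) :
  gmm_valid p -> nontrivial p -> 0 < weight p < 1.
Proof.
move=> [/andP[a0 a1] S1 S2] nt; rewrite !lt_neqAle a0 a1 !andbT.
apply/andP; split; apply/eqP => a; apply: nt.
  exists (mean2 p), (cov2 p); split=> // x.
  by rewrite /gmm_density -a mul0r add0r subr0 mul1r.
exists (mean1 p), (cov1 p); split=> // x.
by rewrite /gmm_density a subrr mul0r addr0 mul1r.
Qed.

Lemma nontrivial_components (R : realType) n (p : gmm_param R n) :
  gmm_valid p -> nontrivial p -> mean1 p = mean2 p -> cov1 p = cov2 p -> False.
Proof.
move=> [_ S1 _] nt m12 S12; apply: nt; exists (mean1 p), (cov1 p); split=> // x.
by rewrite /gmm_density -m12 -S12 -mulrDl addrC subrK mul1r.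
Qed.

(* With the data separated by diagonal quadratic functions, the first two
   weighted moments of the sample determine the posterior weights. *)
Lemma algebraic_posterior (R : realType) n N (q : 'I_N -> 'cV[rat]_n)
    (r : 'I_N -> R) (a : R) (m : 'cV[R]_n) (S : 'M[R]_n)
    (x := fun k => map_mx (ratr : rat -> R) (q k)) (k0 : 'I_N) :
  (exists (c : rat) (b d : 'I_n -> rat), forall k,
     c + \sum_j (b j * q k j 0 + d j * q k j 0 ^+ 2) = (q k == q k0)%:R) ->
  (forall k, q k = q k0 -> r k = r k0) ->
  \sum_k r k = a -> \sum_k r k *: (x k - m) = 0 ->
  \sum_k r k *: ((x k - m) *m (x k - m)^T - S) = 0 ->
  algebraicOver (ratr : rat -> R) a ->
  (forall j, algebraicOver (ratr : rat -> R) (m j 0)) ->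
  (forall j, algebraicOver (ratr : rat -> R) (S j j)) ->
  algebraicOver (ratr : rat -> R) (r k0).
Proof.
move=> [c [b [d sep]]] rq r0 r1 r2 aa am aS.
have E1 j : \sum_k r k * x k j 0 = a * m j 0.
  have /matrixP/(_ j 0) := r1; rewrite summxE mxE => H.
  apply/eqP; rewrite -r0 mulr_suml -subr_eq0 -sumrB -[X in _ == X]H.
  by apply/eqP/eq_bigr => k _; rewrite !mxE mulrBr.
have E2 j : \sum_k r k * x k j 0 ^+ 2 = a * (S j j + m j 0 ^+ 2).
  have /matrixP/(_ j j) := r2; rewrite summxE mxE => H.
  have : \sum_k r k * x k j 0 ^+ 2 =
      \sum_k (r k *: ((x k - m) *m (x k - m)^T - S)) j j +
      (2 * m j 0) * (\sum_k r k * x k j 0) + (\sum_k r k) * (S j j - m j 0 ^+ 2).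
    rewrite mulr_sumr mulr_suml -!big_split; apply: eq_bigr => k _ /=.
    by rewrite !mxE big_ord1 !mxE; ring.
  by move=> ->; rewrite H E1 r0; ring.
(* Sample points may repeat: [C] is the multiplicity of [q k0], and summing [r] against the
   indicator of this point yields [C * r k0]. *)
pose C := \sum_(k < N) ((q k == q k0)%:R : R).
have C0 : C != 0.
  rewrite /C (bigD1 k0) //= eqxx gt_eqF // ltr_wpDr ?ltr01 //.
  by apply: sumr_ge0 => k _; rewrite ler0n.
have CE : C * r k0 = ratr c * a +
    \sum_j (ratr (b j) * (a * m j 0) + ratr (d j) * (a * (S j j + m j 0 ^+ 2))).
  under [in RHS]eq_bigr do rewrite -E1 -E2 !mulr_sumr -big_split /=.
  rewrite exchange_big -r0 mulr_sumr mulr_suml -big_split; apply: eq_bigr => k _ /=.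
  have -> : (q k == q k0)%:R * r k0 = (q k == q k0)%:R * r k.
    by case: eqVneq => [/rq ->|_] //; rewrite !mul0r.
  rewrite -(ratr_nat R) -sep rmorphD rmorph_sum /= mulrDl mulr_suml.
  congr (_ + _); apply: eq_bigr => j _.
  by rewrite rmorphD !rmorphM /= !mxE; ring.
rewrite -(mulKf C0 (r k0)) CE; apply: algebraic_mul.
  by apply/algebraic_inv/algebraic_sum => k _; exact: algebraic_nat.
apply: algebraic_add; first by apply: algebraic_mul => //; exact: algebraic_rat.
apply: algebraic_sum => j _; apply: algebraic_add.
  by apply: algebraic_mul; [exact: algebraic_rat|exact: algebraic_mul].
apply: algebraic_mul; first exact: algebraic_rat.
by apply: algebraic_mul => //; apply: algebraic_add => //; exact: algebraic_exp.
Qed.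

Lemma transcendental_coordinate (R : realType) n N (q : 'I_N -> 'cV[rat]_n.+1)
    (p : gmm_param R n.+1) : (0 < N)%N ->
  (forall k0, exists (c : rat) (b d : 'I_n.+1 -> rat), forall k,
     c + \sum_j (b j * q k j 0 + d j * q k j 0 ^+ 2) = (q k == q k0)%:R) ->
  nontrivial_critical_point (fun k => map_mx (ratr : rat -> R) (q k)) p ->
  exists z, coordinate p z /\ transcendental z.
Proof.
move=> N0 sep [pc nt]; apply: contrapT => alg_coord.
have palg z : coordinate p z -> algebraicOver (ratr : rat -> R) z.
  by move=> pz; apply: contrapT => zt; apply: alg_coord; exists z.
have aw : algebraicOver (ratr : rat -> R) (weight p) by apply: palg; constructor 1.
have am1 i : algebraicOver (ratr : rat -> R) (mean1 p i 0).
  by apply: palg; constructor 2; exists i; left.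
have am2 i : algebraicOver (ratr : rat -> R) (mean2 p i 0).
  by apply: palg; constructor 2; exists i; right.
have aS1 i j : algebraicOver (ratr : rat -> R) (cov1 p i j).
  by apply: palg; constructor 3; exists i, j; left.
have aS2 i j : algebraicOver (ratr : rat -> R) (cov2 p i j).
  by apply: palg; constructor 3; exists i, j; right.
have pv : gmm_valid p by case: (p) pc => a m1 m2 S1 S2 [].
have w01 := nontrivial_weight pv nt; have [w0 w1] := andP w01.
have w1' : 0 < 1 - weight p by rewrite subr_gt0.
have [_ S1p S2p] := pv.
pose x k := map_mx (ratr : rat -> R) (q k).
have [r0 r1 _ r2 _] := (critical_pointP x pv w01).1 pc.
have [_ _ r1' _ r2'] := (critical_pointP x pv w01).1 pc.
pose r k := posterior p (x k).
have aN : algebraicOver (ratr : rat -> R) (N%:R * weight p).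
  by apply: algebraic_mul => //; exact: algebraic_nat.
have ar k : algebraicOver (ratr : rat -> R) (r k).
  have rq l : q l = q k -> r l = r k by move=> ql; rewrite /r /x ql.
  exact: (@algebraic_posterior R n.+1 N q r _ _ (cov1 p) k
            (sep k) rq r0 r1 r2 aN am1 (fun j => aS1 j j)).
have D1 := posdefmx_det_gt0 S1p; have D2 := posdefmx_det_gt0 S2p.
pose g1 k := gaussian (mean1 p) (cov1 p) (x k).
pose g2 k := gaussian (mean2 p) (cov2 p) (x k).
have g1_gt0 k : 0 < g1 k by exact: gaussian_gt0.
have g2_gt0 k : 0 < g2 k by exact: gaussian_gt0.
have f0 k : 0 < weight p * g1 k + (1 - weight p) * g2 k.
  by rewrite addr_gt0 // mulr_gt0.
have rE k : r k = weight p * g1 k / (weight p * g1 k + (1 - weight p) * g2 k) by [].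
have ratio k : g2 k / g1 k = (1 - r k) / r k * (weight p / (1 - weight p)).
  by rewrite rE; field; apply/and4P; split; exact: lt0r_neq0.
pose Q (m : 'cV[R]_n.+1) (S : 'M[R]_n.+1) (k : 'I_N) : R := ((x k - m)^T *m invmx S *m (x k - m)) 0 0.
have ax k i j : algebraicOver (ratr : rat -> R) (x k i j).
  by rewrite mxE; exact: algebraic_rat.
have aQ (m : 'cV[R]_n.+1) (S : 'M[R]_n.+1) k : (forall i, algebraicOver (ratr : rat -> R) (m i 0)) ->
    (forall i j, algebraicOver (ratr : rat -> R) (S i j)) ->
    algebraicOver (ratr : rat -> R) (Q m S k).
  move=> am aS; have axm i j : algebraicOver (ratr : rat -> R) ((x k - m) i j).
    rewrite mxE [(- m) i j]mxE; apply: algebraic_sub; first exact: ax.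
    by rewrite (ord1 j).
  apply: algebraic_mulmx => // i j; apply: algebraic_mulmx => [{}i {}j|{}i {}j].
    by rewrite mxE.
  exact: algebraic_invmx.
have ratio2 k : (g2 k / g1 k) ^+ 2 = \det (cov1 p) / \det (cov2 p) *
    expR (Q (mean1 p) (cov1 p) k - Q (mean2 p) (cov2 p) k).
  rewrite expr_div_n !sqr_gaussian // expRB !expRN -!/(Q _ _ _).
  have e1 := expR_gt0 (Q (mean1 p) (cov1 p) k).
  have e2 := expR_gt0 (Q (mean2 p) (cov2 p) k).
  have c0 : 0 < (2 * pi : R) `^ (- (n.+1%:R / 2)) by rewrite powR_gt0 // mulr_gt0 ?pi_gt0.
  move: (expR _) (expR _) (_ `^ _) (\det _) (\det _) e1 e2 c0 D1 D2 => u v w s t *.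
  by field; apply/and5P; split; exact: lt0r_neq0.
(* The exponential of this difference is algebraic, being the squared density ratio times a ratio of
   determinants, and so is the difference itself; Hermite-Lindemann makes it zero. *)
have Q12 k : Q (mean1 p) (cov1 p) k - Q (mean2 p) (cov2 p) k = 0.
  apply/eqP; apply: contrapT => /negP Q0.
  have aQQ : algebraicOver (ratr : rat -> R)
      (Q (mean1 p) (cov1 p) k - Q (mean2 p) (cov2 p) k).
    by apply: algebraic_sub; exact: aQ.
  apply: (hermite_lindemann aQQ Q0).
  have -> : expR (Q (mean1 p) (cov1 p) k - Q (mean2 p) (cov2 p) k) =
      (g2 k / g1 k) ^+ 2 * (\det (cov2 p) / \det (cov1 p)).
    by rewrite ratio2; field; rewrite !gt_eqF.
  apply: algebraic_mul; last first.
    by apply: algebraic_div; exact: algebraic_det.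
  rewrite ratio; apply: algebraic_exp; apply: algebraic_mul.
    apply: algebraic_div => //; apply: algebraic_sub => //; exact: algebraic1.
  by apply: algebraic_div => //; apply: algebraic_sub => //; exact: algebraic1.
pose k0 := Ordinal N0.
have ratio0 k : g2 k / g1 k = g2 k0 / g1 k0.
  have pos l : 0 <= g2 l / g1 l by apply: divr_ge0; exact: ltW.
  by apply/eqP; rewrite -(@eqrXn2 R 2 _ _ isT (pos k) (pos k0)) !ratio2 !Q12.
have rk0 k : r k = r k0.
  have rg l : r l = weight p / (weight p + (1 - weight p) * (g2 l / g1 l)).
    rewrite rE; field.
    by rewrite !lt0r_neq0 // ?addr_gt0 ?mulr_gt0 ?divr_gt0.
  by rewrite !rg ratio0.
have NR0 : N%:R != 0 :> R by rewrite pnatr_eq0 -lt0n.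
(* Constant posteriors must equal the weight, since they sum to [N] times it. *)
have rw k : r k = weight p.
  apply: (mulfI NR0); rewrite -r0 mulr_natl -[N in LHS]card_ord -sumr_const.
  by apply: eq_bigr => l _; rewrite -/(r l) (rk0 l) (rk0 k).
(* With constant nonzero weights the critical equations make both means the sample mean, and then
   both covariances the sample covariance. *)
have cancel_sum m (y : 'I_N -> 'M[R]_(n.+1, m)) c (f : 'I_N -> R) M : c != 0 ->
    (forall k, f k = c) -> \sum_k f k *: (y k - M) = 0 ->
    M = N%:R^-1 *: \sum_k y k.
  move=> c0 fc; under eq_bigr do rewrite fc.
  rewrite -scaler_sumr => /(congr1 ( *:%R c^-1)).
  rewrite scalerA mulVf // scale1r scaler0 sumrB sumr_const card_ord.
  by move=> /subr0_eq ->; rewrite -(scaler_nat N M) scalerA mulVf // scale1r.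
have rw' k : 1 - posterior p (x k) = 1 - weight p by rewrite -/(r k) rw.
have m12 : mean1 p = mean2 p.
  rewrite (cancel_sum _ _ _ _ _ (lt0r_neq0 w0) rw r1).
  by rewrite (cancel_sum _ _ _ _ _ (lt0r_neq0 w1') rw' r1').
apply: (nontrivial_components pv nt m12).
rewrite (cancel_sum _ _ _ _ _ (lt0r_neq0 w0) rw r2).
by rewrite (cancel_sum _ _ _ _ _ (lt0r_neq0 w1') rw' r2') m12.
Qed.

(** * The sample *)

(* Every index [(j, b, s)] gives a vertex [(-1)^s e_l] of the cross-polytope or
   the origin; [b] repeats the vertices on the first axis so that the first
   coordinate has second moment [1 / 2] in every dimension. *)
Definition sample n (t : 'I_n.+1 * bool * bool) : 'cV[rat]_n.+1 :=
  ((-1) ^+ t.2 * (t.1.2 || (t.1.1 != 0))%:R) *: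
    delta_mx (if t.1.2 then 0 else t.1.1) 0.

Definition vertex n (o : option ('I_n * bool)) : 'cV[rat]_n :=
  if o is Some (l, s) then (-1) ^+ s *: delta_mx l 0 else 0.

Lemma sampleE n (t : 'I_n.+1 * bool * bool) : exists o, sample t = vertex o.
Proof.
case: t => -[j b] s; rewrite /sample /=.
case: b => /=; first by exists (Some (0, s)); rewrite mulr1.
case: eqVneq => [->|j0] /=; first by exists None; rewrite mulr0 scale0r.
by exists (Some (j, s)); rewrite mulr1.
Qed.

(** The indicator of a vertex [e] or [- e] on axis [l] is [(x_l^2 + x_l) / 2] or
    [(x_l^2 - x_l) / 2], and that of the origin is [1 - \sum_j x_j^2]. *)
Lemma separating_quadratic n (o0 : option ('I_n * bool)) :
  exists (c : rat) (b d : 'I_n -> rat), forall o : option ('I_n * bool),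
    c + \sum_j (b j * vertex o j 0 + d j * vertex o j 0 ^+ 2) =
    (vertex o == vertex o0)%:R.
Proof.
(* Separating the labels suffices: equal vertices give equal values of the quadratic, hence equal
   labels. *)
suff [c [b [d H]]] : exists (c : rat) (b d : 'I_n -> rat), forall o : option ('I_n * bool),
    c + \sum_j (b j * vertex o j 0 + d j * vertex o j 0 ^+ 2) = (o == o0)%:R.
  exists c, b, d => o; rewrite H; case: (eqVneq o o0) => [->|oo0].
    by rewrite eqxx.
  case: eqVneq => // E; have := H o0; rewrite -E H eqxx (negPf oo0).
  by move/eqP.
have v0 j : (0 : 'cV[rat]_n) j 0 = 0 by rewrite mxE.
have vS l s j : vertex (Some (l, s)) j 0 = (-1) ^+ s * (j == l)%:R.
  by rewrite !mxE eqxx andbT.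
case: o0 => [[l0 s0]|].
  exists 0, (fun j => (j == l0)%:R * ((-1) ^+ s0 / 2)), (fun j => (j == l0)%:R / 2) => o.
  rewrite add0r (bigD1 l0) //= big1 => [|j jl0]; last first.
    by rewrite (negPf jl0) !mul0r add0r.
  rewrite eqxx addr0 !mul1r; case: o => [[l s]|]; last first.
    by rewrite v0 mulr0 expr0n mulr0 addr0.
  rewrite vS; have [->|l0l] := eqVneq l0 l; last first.
    rewrite mulr0 mulr0 expr0n mulr0 addr0.
    by case: eqP => // -[] ll; rewrite ll eqxx in l0l.
  case: s0; case: s; rewrite /= ?expr0 ?expr1.
  - by rewrite eqxx /=; field.
  - rewrite (_ : (Some (l, false) == Some (l, true)) = false) /=; first by field.
    by apply/eqP => -[].
  - rewrite (_ : (Some (l, true) == Some (l, false)) = false) /=; first by field.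
    by apply/eqP => -[].
  - by rewrite eqxx /=; field.
exists 1, (fun=> 0), (fun=> -1) => -[[l s]|] /=; last first.
  by rewrite big1 ?addr0 // => j _; rewrite v0 mul0r expr0n mulr0 addr0.
rewrite (bigD1 l) //= big1 => [|j jl]; last first.
  by rewrite vS (negPf jl) mulr0 mul0r expr0n mulr0 addr0.
by rewrite vS eqxx mulr1 mul0r sqrr_sign; ring.
Qed.

Lemma sample_coord n j b s (i : 'I_n.+1) :
  sample (j, b, s) i 0 =
  (-1) ^+ s * (if b then (i == 0)%:R else ((j != 0) && (i == j))%:R).
Proof.
rewrite !mxE eqxx andbT /= -mulrA -natrM mulnb.
by case: b.
Qed.

Lemma sample_coord0 n (t : 'I_n.+1 * bool * bool) :
  [|| sample t 0 0 == 0, sample t 0 0 == 1 | sample t 0 0 == -1].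
Proof.
case: t => -[j b] s; rewrite sample_coord.
have -> : (j != 0) && (0 == j) = false by case: eqVneq => // ->; rewrite eqxx.
by case: b; case: s; rewrite ?mulr0 ?mulr1 ?eqxx ?orbT.
Qed.

Lemma sum_sample_odd (V : zmodType) n (f : 'cV[rat]_n.+1 -> V) :
  (forall x, f (- x) = - f x) -> \sum_(t : 'I_n.+1 * bool * bool) f (sample t) = 0.
Proof.
move=> fN; rewrite -(pair_bigA _ (fun a s => f (sample (a, s)))) /= big1 // => a _.
rewrite big_bool /= (_ : sample (a, true) = - sample (a, false)) ?fN ?addNr //.
by rewrite /sample /= expr1 expr0 mulN1r mul1r scaleNr.
Qed.

(** Of the [4 (n + 1)] points, [2 (n + 1)] are vertices on the first axis, two lie on each other
    axis, and two are the origin. *)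
Lemma sum_sample_sqr n (i l : 'I_n.+1) :
  \sum_(t : 'I_n.+1 * bool * bool) sample t i 0 * sample t l 0 =
  ((i == l)%:R * (if i == 0 then 2 * n.+1%:R else 2)).
Proof.
rewrite -(pair_bigA _ (fun a s => sample (a, s) i 0 * sample (a, s) l 0)) /=.
rewrite -(pair_bigA _ (fun j b => \sum_s sample ((j, b), s) i 0 * sample ((j, b), s) l 0)) /=.
under eq_bigr => j _ do rewrite !big_bool /= !sample_coord /= expr1 expr0 !mulN1r !mul1r !mulrNN.
rewrite !big_split /= !sumr_const !card_ord.
have -> : \sum_j ((j != 0) && (i == j))%:R * ((j != 0) && (l == j))%:R =
   ((i != 0) && (i == l))%:R :> rat.
  rewrite (bigD1 i) //= big1 => [|j ji]; last first.
    by rewrite (eq_sym i) (negPf ji) andbF mul0r.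
  by rewrite addr0 eqxx andbT (eq_sym l); case: (i != 0); rewrite ?mul1r ?mul0r.
case: (eqVneq i l) => [<-|il].
  by rewrite andbT mul1r; case: (i == 0) => /=; ring.
rewrite -!natrM !mulnb andbF mul0r.
have -> : (i == 0) && (l == 0) = false.
  by apply/negP => /andP[/eqP i0 /eqP l0]; rewrite i0 l0 eqxx in il.
by rewrite mul0rn !addr0.
Qed.

(** * Existence of a non-trivial critical point *)

(** The equation makes the logistic posterior agree with [(1 - t x) / 2] at [x = 1] and [x = -1]. It
    has the trivial root [t = 0], so the search starts at 1/2, where [exp(8/7) >= (15/14)^16 > 3].
    Clearing [1 - t] gives a function continuous up to 1, with value -2 there. *)
Lemma ex_stationary_separation (R : realType) :
  exists2 t : R, 0 < t < 1 & expR (t / (1 / 2 - t ^+ 2 / 4)) = (1 + t) / (1 - t).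
Proof.
pose f (t : R) := expR (t * (1 / 2 - t ^+ 2 / 4)^-1) * (1 - t) - (1 + t).
have le_half : (1 / 2 : R) <= 1 by lra.
have den (t : R) : 0 <= t <= 1 -> 1 / 2 - t ^+ 2 / 4 != 0.
  by move=> /andP[t0 t1]; rewrite gt_eqF //; nra.
have fc : {within `[(1 / 2 : R), 1], continuous f}%classic.
  apply: derivable_within_continuous => t; rewrite in_itv /= => /andP[t0 t1].
  have t01 : 0 <= t <= 1 by rewrite t1 andbT; lra.
  have cd (c : R) : is_derive t (1 : R) (fun=> c) 0 by exact: is_derive_cst.
  have h1 := is_deriveB (cd (1 / 2)) (is_derive1M (is_derive1X 2 (is_derive1_id t)) (cd 4^-1)).
  have h2 := is_derive1M (is_derive1_id t) (@is_deriveV R (fun t => 1 / 2 - t ^+ 2 / 4) t _ 1 (den t t01) h1).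
  have h3 := is_deriveB (is_derive1M (is_derive1_expR h2) (is_deriveB (cd 1) (is_derive1_id t)))
     (is_deriveD (cd 1) (is_derive1_id t)).
  by case: h3.
have f1 : f 1 < 0 by rewrite /f subrr mulr0 add0r; lra.
have f0 : 0 < f (1 / 2).
  rewrite /f; have -> : (1 / 2 : R) * (1 / 2 - (1 / 2) ^+ 2 / 4)^-1 = 16%:R * 14^-1 by field.
  rewrite expRM_natl.
  have e1 : 15 / 14 <= expR (14^-1 : R).
    by apply: le_trans (expR_ge1Dx _); rewrite (_ : 15 / 14 = 1 + 14^-1) //; field.
  have e2 : (15 / 14) ^+ 16 <= expR (14^-1 : R) ^+ 16.
    by rewrite lerXn2r // nnegrE ?expR_ge0 // divr_ge0.
  have e3 : 3 < (15 / 14 : R) ^+ 16 by lra.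
  lra.
have [|t] := @IVT R f (1 / 2) 1 0 le_half fc.
  by rewrite ge_min le_max (ltW f1) (ltW f0) orbT.
rewrite in_itv /= => /andP[t0 t1] ft; exists t.
  apply/andP; split; first by lra.
  by rewrite lt_neqAle t1 andbT; apply: contraTneq f1 => <-; rewrite ft ltxx.
have t1' : 1 - t != 0.
  by rewrite subr_eq0; apply: contraTneq f1 => ->; rewrite ft ltxx.
apply: (mulIf t1'); rewrite divfK //; apply/eqP; rewrite -subr_eq0; apply/eqP.
exact: ft.
Qed.

Section SymmetricMixture.
Variables (R : realType) (n : nat) (t : R).
Hypothesis t01 : 0 < t < 1.
Hypothesis tE : expR (t / (1 / 2 - t ^+ 2 / 4)) = (1 + t) / (1 - t).

Let e0 : 'cV[R]_n.+1 := delta_mx 0 0.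
(** Variance within each component on the first axis: the second moment 1/2 of the sample minus the
    squared mean [(t / 2)^2]. *)
Let s : R := 1 / 2 - t ^+ 2 / 4.
Let var (j : 'I_n.+1) : R := if j == 0 then s else (2 * n.+1%:R)^-1.
Let cov : 'M[R]_n.+1 := diag_mx (\row_j var j).

Definition symmetric_mixture : gmm_param R n.+1 :=
  GmmParam (1 / 2) (- (t / 2) *: e0) ((t / 2) *: e0) cov cov.

Let s0 : 0 < s.
Proof. by case/andP: t01 => t0 t1; rewrite /s; nra. Qed.

Let var_gt0 j : 0 < var j.
Proof. by rewrite /var; case: eqP => // _; rewrite invr_gt0 mulr_gt0 // ltr0n. Qed.

Let quadE (v : 'cV[R]_n.+1) :
  (v^T *m cov *m v) 0 0 = \sum_j var j * v j 0 ^+ 2.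
Proof.
rewrite mxE; apply: eq_bigr => j _; rewrite mul_mx_diag !mxE; ring.
Qed.

Let cov_posdef : posdefmx cov.
Proof.
split; first by rewrite tr_diag_mx.
move=> v v0; rewrite quadE lt_neqAle sumr_ge0 ?andbT; last first.
  by move=> j _; rewrite mulr_ge0 ?sqr_ge0 // ltW.
apply: contra_neqN v0 => /eqP/esym/psumr_eq0P H; apply/colP => i.
rewrite [RHS]mxE; apply/eqP; rewrite -sqrf_eq0.
have /eqP := H (fun j _ => mulr_ge0 (ltW (var_gt0 j)) (sqr_ge0 _)) i isT.
by rewrite mulf_eq0 gt_eqF.
Qed.

Let inv_cov : invmx cov = diag_mx (\row_j (var j)^-1).
Proof.
have H : cov *m diag_mx (\row_j (var j)^-1) = 1%:M.
  apply/matrixP => i j; rewrite mul_diag_mx !mxE.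
  by case: eqP => [->|_]; rewrite ?mulr0n ?mulr0 // mulr1n divff // gt_eqF.
by rewrite -[LHS]mulmx1 -H mulmxA mulVmx ?mul1mx // posdefmx_unit.
Qed.

Let gaussianE (c : R) (x : 'cV[R]_n.+1) :
  gaussian (c *: e0) cov x =
  (2 * pi) `^ (- (n.+1%:R / 2)) * (\det cov) `^ (- (1 / 2)) *
  expR (- (1 / 2) * \sum_(j | j != 0) x j 0 ^+ 2 / var j) *
  expR (- (1 / 2) * ((x 0 0 - c) ^+ 2 / s)).
Proof.
rewrite /gaussian -[RHS]mulrA -expRD -mulrDr; congr (_ * expR (_ * _)).
rewrite inv_cov mxE (bigD1 0) //= [RHS]addrC; congr (_ + _).
  by rewrite mul_mx_diag !mxE eqxx /var eqxx /=; ring.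
apply: eq_bigr => j j0; rewrite mul_mx_diag !mxE (negPf j0) /=; ring.
Qed.

Lemma symmetric_mixture_valid : gmm_valid symmetric_mixture.
Proof. by split=> //=; lra. Qed.

(** Equal covariances make the log ratio of the components linear, equal to [(t / s) x_0]. The
    posterior is thus logistic in [x_0], and [tE] makes it coincide with an affine function at -1, 0
    and 1. *)
Lemma posterior_symmetric_mixture (x : 'cV[R]_n.+1) :
  [|| x 0 0 == 0, x 0 0 == 1 | x 0 0 == -1] ->
  posterior symmetric_mixture x = (1 - t * x 0 0) / 2.
Proof.
move=> xE; have [t0 t1] := andP t01.
have g0 c : 0 < gaussian (c *: e0) cov x by exact: gaussian_gt0.
have ratio : gaussian ((t / 2) *: e0) cov x =
    gaussian (- (t / 2) *: e0) cov x * expR (t / s * x 0 0).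
  rewrite !gaussianE -!mulrA; congr (_ * (_ * (_ * _))).
  by rewrite -expRD; congr expR; field; rewrite gt_eqF.
have -> : posterior symmetric_mixture x = (1 + expR (t / s * x 0 0))^-1.
  rewrite /posterior /gmm_density /= ratio.
  have := g0 (- (t / 2)); have := expR_gt0 (t / s * x 0 0).
  move: (gaussian _ _ _) (expR _) => g e e_gt0 g_gt0.
  have -> : 1 / 2 * g + (1 - 1 / 2) * (g * e) = 1 / 2 * g * (1 + e) by field.
  by field; rewrite !gt_eqF // addr_gt0.
have t1' : 1 - t != 0 by rewrite subr_eq0 gt_eqF.
have t1'' : 1 + t != 0 by rewrite gt_eqF // addr_gt0.
case/or3P: xE => /eqP ->.
- by rewrite mulr0 expR0 mulr0; field.
- by rewrite mulr1 tE; field; rewrite t1' /=; lra.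
- by rewrite mulrN1 expRN tE; field; rewrite t1'' t1' /=; lra.
Qed.

(** The logarithm of a Gaussian density is quadratic along the first axis, so its third difference
    over -1, 0, 1, 2 vanishes; [gauss_id] is the multiplicative form of this. *)
Lemma symmetric_mixture_nontrivial : nontrivial symmetric_mixture.
Proof.
have [t0 t1] := andP t01.
move=> [m [S [Sp fE]]]; have [St _] := Sp.
pose f y := gmm_density symmetric_mixture (y *: e0).
have gauss_id : f 1 ^+ 3 * f (-1) = f 2 * f 0 ^+ 3.
  pose q (u v : 'cV[R]_n.+1) : R := (u^T *m invmx S *m v) 0 0.
  have F y : f y = (2 * pi) `^ (- (n.+1%:R / 2)) * (\det S) `^ (- (1 / 2)) *
      expR (- (1 / 2) * (y ^+ 2 * q e0 e0 - y * (q e0 m + q m e0) + q m m)).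
    rewrite /f fE /gaussian; congr (_ * expR (_ * _)).
    rewrite /q [_^T]linearB /= [(_ *: e0)^T]linearZ /= mulmxBl mulmxBl !mulmxBr.
    rewrite -!scalemxAl -!scalemxAr.
    by move: (_ *m e0) (_ *m m) (_ *m e0) (_ *m m) => A B C D; rewrite !mxE; ring.
  rewrite [RHS]mulrC !F; set k := _ `^ _ * _ `^ _; move: k => k.
  rewrite !exprMn -!expRM_natl mulrACA [RHS]mulrACA -!expRD.
  by congr (_ * expR _); ring.
have f_val y : f y = (2 * pi) `^ (- (n.+1%:R / 2)) * (\det cov) `^ (- (1 / 2)) *
    expR (- (t ^+ 2 / (8 * s))) * expR (- (y ^+ 2 / (2 * s))) *
    ((expR (y * (t / (2 * s))) + expR (- (y * (t / (2 * s))))) / 2).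
  have sum0 : \sum_(j < n.+1 | j != 0) (y *: e0) j 0 ^+ 2 / var j = 0.
    by apply: big1 => j j0; rewrite !mxE (negPf j0) mulr0 expr0n mul0r.
  have y0 : (y *: e0) 0 0 = y by rewrite !mxE mulr1.
  rewrite /f /gmm_density /= !gaussianE sum0 mulr0 expR0 mulr1 y0.
  set k := _ `^ _ * _ `^ _; move: k => k.
  have E1 : expR (- (1 / 2) * ((y - - (t / 2)) ^+ 2 / s)) =
      expR (- (t ^+ 2 / (8 * s))) * expR (- (y ^+ 2 / (2 * s))) *
      expR (- (y * (t / (2 * s)))).
    by rewrite -!expRD; congr expR; field; rewrite gt_eqF.
  have E2 : expR (- (1 / 2) * ((y - t / 2) ^+ 2 / s)) =
      expR (- (t ^+ 2 / (8 * s))) * expR (- (y ^+ 2 / (2 * s))) *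
      expR (y * (t / (2 * s))).
    by rewrite -!expRD; congr expR; field; rewrite gt_eqF.
  by rewrite E1 E2; field.
pose z := expR (t / (2 * s)).
have z1 : 1 < z by rewrite -expR0 ltr_expR divr_gt0 // mulr_gt0.
pose E := expR (- (2 * s)^-1).
pose k := (2 * pi) `^ (- (n.+1%:R / 2)) * (\det cov) `^ (- (1 / 2)) *
  expR (- (t ^+ 2 / (8 * s))).
have k0 : 0 < k.
  have d0 := posdefmx_det_gt0 cov_posdef.
  apply: mulr_gt0 (expR_gt0 _); apply: mulr_gt0; rewrite powR_gt0 //.
  by rewrite mulr_gt0 ?pi_gt0.
have E0 : 0 < E by exact: expR_gt0.
have f0E : f 0 = k.
  by rewrite f_val -/k expr0n !mul0r oppr0 expR0; field.
have f1E : f 1 = k * E * ((z + z^-1) / 2).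
  by rewrite f_val -/k expr1n !mul1r -/E expRN -/z.
have fN1E : f (-1) = k * E * ((z + z^-1) / 2).
  rewrite f_val -/k sqrrN expr1n mul1r mulN1r opprK -/E expRN -/z.
  by rewrite [z + _]addrC.
have f2E : f 2 = k * E ^+ 4 * ((z ^+ 2 + z ^- 2) / 2).
  have e4 : - (2 ^+ 2 / (2 * s)) = 4 * - (2 * s)^-1 by ring.
  by rewrite f_val -/k e4 !expRM_natl -/E [in X in _ + X]expRN expRM_natl -/z.
have z0 : z != 0 by rewrite gt_eqF // (lt_trans ltr01).
(* For the mixture, the defect in [gauss_id] is a positive multiple of [(z^2 - 1)^4], while
   [z > 1]. *)
have : (z ^+ 2 - 1) ^+ 4 = 0.
  have -> : (z ^+ 2 - 1) ^+ 4 = 16 * z ^+ 4 / (k * E) ^+ 4 *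
      (f 1 ^+ 3 * f (-1) - f 2 * f 0 ^+ 3).
    by rewrite f0E f1E fN1E f2E; field; rewrite z0 !gt_eqF.
  by rewrite gauss_id subrr mulr0.
move/eqP; rewrite expf_eq0 /= subr_eq0 => /eqP z2.
suff : 1 < z ^+ 2 by rewrite z2 ltxx.
by rewrite exprn_egt1.
Qed.

(** On the sample the posteriors are affine in the first coordinate, so the critical equations
    involve only sample moments of order at most three, all given by the hypotheses. *)
Lemma symmetric_mixture_critical N (x : 'I_N -> 'cV[R]_n.+1) :
  (forall k, [|| x k 0 0 == 0, x k 0 0 == 1 | x k 0 0 == -1]) ->
  (forall i, \sum_k x k i 0 = 0) ->
  (forall i j, \sum_k x k i 0 * x k j 0 =
     (i == j)%:R * (N%:R * (if i == 0 then 1 / 2 else (2 * n.+1%:R)^-1))) ->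
  (forall i j, \sum_k x k 0 0 * (x k i 0 * x k j 0) = 0) ->
  critical_point x symmetric_mixture.
Proof.
move=> x0 m1 m2 m3; have [t0 t1] := andP t01.
have h01 : 0 < (1 / 2 : R) < 1 by lra.
apply/(critical_pointP x symmetric_mixture_valid h01).
have rE k : posterior symmetric_mixture (x k) = (1 - t * x k 0 0) / 2.
  exact: posterior_symmetric_mixture.
have r'E k : 1 - posterior symmetric_mixture (x k) = (1 + t * x k 0 0) / 2.
  by rewrite rE; field.
have sumc (c : R) : \sum_(k < N) c = N%:R * c by rewrite sumr_const card_ord mulr_natl.
have e0E i : e0 i 0 = (0 == i)%:R by rewrite mxE eqxx andbT eq_sym.
(* Taking [c] to be [- (t / 2)] or [t / 2] treats both components at once: the mean is [c e0] and
   the posterior [(1 + 2 c x_0) / 2]. *)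
have first_moment (c : R) : \sum_k (1 + 2 * c * x k 0 0) / 2 *: (x k - c *: e0) = 0.
  apply/colP => i; rewrite summxE [RHS]mxE.
  under eq_bigr => k _ do rewrite !mxE eqxx andbT eq_sym.
  transitivity (1 / 2 * (\sum_k x k i 0) + c * (\sum_k x k 0 0 * x k i 0) -
      c ^+ 2 * (0 == i)%:R * (\sum_k x k 0 0) +
      \sum_(k < N) - (c * (0 == i)%:R / 2)).
    by rewrite !mulr_sumr -sumrN -!big_split; apply: eq_bigr => k _ /=; field.
  by rewrite sumc !m1 m2 eqxx; field.
have second_moment (c : R) : c ^+ 2 = t ^+ 2 / 4 ->
    \sum_k (1 + 2 * c * x k 0 0) / 2 *:
      ((x k - c *: e0) *m (x k - c *: e0)^T - cov) = 0.
  move=> c2; apply/matrixP => i j; rewrite summxE [RHS]mxE.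
  pose V := cov i j; pose a := (0 == i)%:R : R; pose b := (0 == j)%:R : R.
  transitivity (1 / 2 * (\sum_k x k i 0 * x k j 0)
      + c * (\sum_k x k 0 0 * (x k i 0 * x k j 0))
      - c / 2 * b * (\sum_k x k i 0) - c / 2 * a * (\sum_k x k j 0)
      - c ^+ 2 * b * (\sum_k x k 0 0 * x k i 0) - c ^+ 2 * a * (\sum_k x k 0 0 * x k j 0)
      + c * (c ^+ 2 * a * b - V) * (\sum_k x k 0 0)
      + \sum_(k < N) (c ^+ 2 * a * b - V) / 2).
    rewrite !mulr_sumr -!sumrN -!big_split; apply: eq_bigr => k _ /=.
    rewrite mxE [in LHS]mxE [(- cov) i j]mxE -/V mxE big_ord1.
    have ce l : (x k - c *: e0) l 0 = x k l 0 - c * (0 == l)%:R.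
      by rewrite mxE [(- (c *: e0)) l 0]mxE [(c *: e0) l 0]mxE e0E.
    by rewrite [(_^T) _ _]mxE !ce -/a -/b; field.
  rewrite sumc !m1 !m2 m3 !eqxx c2 -/a -/b.
  have -> : V = (i == j)%:R * var i.
    by rewrite /V !mxE mulr_natl.
  rewrite /a /b /var; have [<-|i0] := eqVneq 0 i.
    by case: (0 == j) => /=; rewrite /s; field.
  by case: (eqVneq i j) => [<-|ij] /=; rewrite ?(negPf i0) /=; field;
    rewrite nat1r pnatr_eq0.
split=> /=.
- under eq_bigr do rewrite rE.
  transitivity (- (t / 2) * (\sum_k x k 0 0) + \sum_(k < N) (1 / 2)).
    by rewrite mulr_sumr -big_split; apply: eq_bigr => k _ /=; field.
  by rewrite m1 sumc; ring.
- rewrite -[RHS](first_moment (- (t / 2))); apply: eq_bigr => k _.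
  by rewrite rE; congr (_ / 2 *: _); field.
- rewrite -[RHS](first_moment (t / 2)); apply: eq_bigr => k _.
  by rewrite r'E; congr (_ / 2 *: _); field.
- rewrite -[RHS](second_moment (- (t / 2))); last by field.
  by apply: eq_bigr => k _; rewrite rE; congr (_ / 2 *: _); field.
- rewrite -[RHS](second_moment (t / 2)); last by field.
  by apply: eq_bigr => k _; rewrite r'E; congr (_ / 2 *: _); field.
Qed.

End SymmetricMixture.

Theorem theorem1 (R : realType) (n : nat) (hn : (0 < n)%N) :
  exists (N : nat) (q : 'I_N -> 'cV[rat]_n),
    let x := fun i : 'I_N => map_mx (ratr : rat -> R) (q i) in
    (exists p : gmm_param R n, nontrivial_critical_point x p) /\
    (forall p : gmm_param R n, nontrivial_critical_point x p ->
       exists z : R, coordinate p z /\ transcendental z).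
Proof.
case: n hn => // n _.
pose T : finType := ('I_n.+1 * bool * bool)%type.
have TE : #|T| = (4 * n.+1)%N by rewrite !card_prod card_ord !card_bool -mulnA mulnC.
exists #|T|, (fun k => sample (enum_val k)) => x.
have xE k i : x k i 0 = ratr (sample (enum_val k) i 0) by rewrite /x mxE.
split; last first.
  move=> p; apply: (@transcendental_coordinate R n #|T| (fun k => sample (enum_val k))).
    by rewrite TE.
  move=> k0; have [u0 ->] := sampleE (enum_val k0).
  have [c [b [d H]]] := separating_quadratic u0.
  by exists c, b, d => k; have [u ->] := sampleE (enum_val k).
have sumE (f : 'cV[rat]_n.+1 -> rat) :
    \sum_(k < #|T|) ratr (f (sample (enum_val k))) =
    ratr (\sum_(t : 'I_n.+1 * bool * bool) f (sample t)) :> R.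
  by rewrite rmorph_sum /= [RHS]big_enum_val.
have [t t01 tE] := ex_stationary_separation R.
exists (symmetric_mixture n t); split; last exact: symmetric_mixture_nontrivial.
apply: symmetric_mixture_critical => // [k|i|i j|i j].
- have /or3P := sample_coord0 (enum_val k); rewrite xE.
  by case=> /eqP ->; rewrite ?rmorph0 ?rmorphN1 ?rmorph1 eqxx ?orbT.
- under eq_bigr do rewrite xE.
  rewrite (sumE (fun y => y i 0)) (@sum_sample_odd _ n (fun y => y i 0)) ?rmorph0 // => y.
  by rewrite mxE.
- under eq_bigr do rewrite !xE -rmorphM /=.
  rewrite (sumE (fun y => y i 0 * y j 0)) sum_sample_sqr rmorphM /= ratr_nat.
  rewrite TE; congr (_ * _).
  case: ifP => _; rewrite ?rmorphM /= !ratr_nat natrM; first by field.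
  by field; rewrite nat1r pnatr_eq0.
- under eq_bigr do rewrite !xE -!rmorphM /=.
  rewrite (sumE (fun y => y 0 0 * (y i 0 * y j 0))) (@sum_sample_odd _ n (fun y => y 0 0 * (y i 0 * y j 0))) ?rmorph0 // => y.
  by rewrite !mxE mulrNN mulNr.
Qed.
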